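(* Let $f\colon[0,1]\to[0,1]$ be a map satisfying the Manneville--Pomeau type conditions (1)--(5) listed in the context. Then there exists $\alpha\in\bigl(0,\frac12\bigr)$ such that for every countable set $P\subset[0,1]$, the set of points $x\in[0,1]$ with $$P\cap\overline{\{f^n x:n\ge0\}}=\emptyset$$ is $\alpha$-strong winning for Schmidt's game on $[0,1]$.
   Context: Conditions on $f$. The map $f\colon[0,1]\to[0,1]$ is a two-branched interval map for which there exists $r_1\in(0,1)$ such that (one-sided derivatives being used where needed): (1) $f((0,r_1))=f((r_1,1))=(0,1)$; (2) $f$ is $C^1$ on $[0,r_1)$ and $C^2$ on $(0,r_1)\cup(r_1,1]$; (3) $f(0)=f(r_1)=0$, $f(1)=1$, $f'(0)=1$, and $|f'|>1$ on $(0,1]$; (4) $\sup_{x\in[0,1]}|f'(x)|<\infty$ and $\sup_{x\in(r_1,1]}|f''(x)|<\infty$; (5) there exist $C\ge1$ and $\gamma>0$ such that $C^{-1}\le f''(x)/x^{\gamma-1}\le C$ for all $x\in(0,r_1)$. Strong Schmidt game. Let $I\subset\mathbb R$ be a compact interval, $\alpha,\beta\in(0,1)$, and $S\subset I$. In the $(\alpha,\beta)$-strong game on $I$ with target set $S$, Bob first chooses any compact (nondegenerate) interval $B_1\subset I$; thereafter Alice and Bob alternately choose nested compact intervals $B_1\supset A_1\supset B_2\supset A_2\supset\cdots$ (Alice chooses the $A_k$, Bob chooses the $B_k$) with $|A_k|\ge\alpha|B_k|$ and $|B_{k+1}|\ge\beta|A_k|$ for all $k\ge1$, where $|\cdot|$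 is length. Alice wins if $\bigcap_{k\ge1}B_k\cap S\ne\emptyset$. The set $S$ is $\alpha$-strong winning (on $I$) if for every $\beta\in(0,1)$ Alice has a winning strategy in the $(\alpha,\beta)$-strong game on $I$ with target set $S$. *)

(* Defs.v *)
From mathcomp Require Import all_boot all_order all_algebra.
From mathcomp Require Import all_classical all_reals all_analysis.
Set Implicit Arguments.
Unset Strict Implicit.
Unset Printing Implicit Defensive.
Import Order.TTheory GRing.Theory Num.Theory.
Import numFieldNormedType.Exports.
Local Open Scope classical_set_scope.
Local Open Scope ring_scope.

(* ** Derivatives relative to a set

   The difference quotient at [x] is restricted to points of [D]: this is the
   usual derivative at interior points of [D] and the one-sided derivative at
   endpoints of an interval. As with [lim], [derive_within D f x] is a junk
   value unless [derivable_within D f x] holds. *)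

Definition derivable_within (R : realType) (D : set R) (f : R -> R) (x : R) :
  Prop := cvg ((fun y => (f y - f x) / (y - x)) @ within D x^').

Definition derive_within (R : realType) (D : set R) (f : R -> R) (x : R) : R :=
  lim ((fun y => (f y - f x) / (y - x)) @ within D x^').

Definition C1_on (R : realType) (D : set R) (f : R -> R) : Prop :=
  (forall x, D x -> derivable_within D f x) /\
  {within D, continuous (derive_within D f)}.

Definition C2_on (R : realType) (D : set R) (f : R -> R) : Prop :=
  C1_on D f /\ C1_on D (derive_within D f).

(* ** Manneville-Pomeau type maps

   [f] jumps at [r1] (its left limit there is 1, its value is 0), so the
   derivative at [r1] is the right derivative: the domain [0, 1] is cut into
   [0, r1) and [r1, 1], and the derivative at [x] is taken inside the piece
   containing [x]. *)

Definition branch (R : realType) (r1 x : R) : set R :=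
  if x < r1 then `[0, r1[%classic else `[r1, 1]%classic.

Definition bderivable (R : realType) (r1 : R) (f : R -> R) (x : R) : Prop :=
  derivable_within (branch r1 x) f x.

Definition bderive (R : realType) (r1 : R) (f : R -> R) (x : R) : R :=
  derive_within (branch r1 x) f x.

(* Only the values of [f] on [0, 1] matter. *)
Record MP_conditions (R : realType) (r1 : R) (f : R -> R) : Prop := {
  mp_r1 : 0 < r1 < 1 ;
  mp_maps : forall x : R, 0 <= x <= 1 -> 0 <= f x <= 1 ;
  mp_onto_l : f @` `]0, r1[%classic = `]0, 1[%classic ;
  mp_onto_r : f @` `]r1, 1[%classic = `]0, 1[%classic ;
  mp_C1 : C1_on `[0, r1[%classic f ;
  mp_C2 : C2_on (`]0, r1[%classic `|` `]r1, 1]%classic) f ;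
  mp_f0 : f 0 = 0 ;
  mp_fr1 : f r1 = 0 ;
  mp_f1 : f 1 = 1 ;
  mp_df0 : bderive r1 f 0 = 1 ;
  (* Differentiability is new information only at [r1], where it is
     presupposed by the next two conditions. *)
  mp_derivable : forall x : R, 0 <= x <= 1 -> bderivable r1 f x ;
  mp_expand : forall x : R, 0 < x <= 1 -> 1 < `|bderive r1 f x| ;
  mp_df_bounded : @has_ubound _ R [set `|bderive r1 f x| | x in `[0, 1]%classic] ;
  mp_ddf_bounded :
    @has_ubound _ R [set `|bderive r1 (bderive r1 f) x| | x in `]r1, 1]%classic] ;
  mp_ddf_order : exists C gamma : R, [/\ 1 <= C, 0 < gamma &
    forall x : R, 0 < x < r1 ->
      C^-1 <= bderive r1 (bderive r1 f) x / x `^ (gamma - 1) <= C]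
}.

Definition MP_map (R : realType) (f : R -> R) : Prop :=
  exists r1 : R, MP_conditions r1 f.

(* ** The strong Schmidt game

   The length conditions force every interval of a legal play to be
   nondegenerate, so nondegeneracy is built into the type of moves. *)

Record cinterval (R : realType) := CInterval {
  lo : R ;
  hi : R ;
  lo_lt_hi : lo < hi
}.

Definition cset (R : realType) (J : cinterval R) : set R :=
  `[lo J, hi J]%classic.

Definition len (R : realType) (J : cinterval R) : R := hi J - lo J.

Definition unit_cinterval (R : realType) : cinterval R :=
  CInterval (@ltr01 R).

(* Rounds are numbered from 0: [B n] and [A n] are the moves B_(n+1) and
   A_(n+1). *)
Definition bob_legal (R : realType) (I : cinterval R) (beta : R)
    (A B : nat -> cinterval R) (n : nat) : Prop :=
  match n with
  | 0%N => cset (B 0%N) `<=` cset I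
  | m.+1 => cset (B m.+1) `<=` cset (A m) /\ beta * len (A m) <= len (B m.+1)
  end.

Definition alice_legal (R : realType) (alpha : R)
    (A B : nat -> cinterval R) (n : nat) : Prop :=
  cset (A n) `<=` cset (B n) /\ alpha * len (B n) <= len (A n).

(* Alice's strategy sees Bob's moves so far; her own earlier moves are
   determined by them. *)
Definition strategy (R : realType) := seq (cinterval R) -> cinterval R.

Definition response (R : realType) (sigma : strategy R)
    (B : nat -> cinterval R) (n : nat) : cinterval R :=
  sigma (mkseq B n.+1).

(* Alice's legality is required after every legal finite play, not only along
   infinite ones: otherwise an illegal move leaving Bob no legal answer would
   count as a win. *)
Definition winning_strategy (R : realType) (I : cinterval R) (alpha beta : R)
    (S : set R) (sigma : strategy R) : Prop :=
  forall B : nat -> cinterval R,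
    let A := response sigma B in
    (forall n, (forall k, (k <= n)%N -> bob_legal I beta A B k) ->
       alice_legal alpha A B n) /\
    ((forall n, bob_legal I beta A B n) ->
       (\bigcap_n cset (B n)) `&` S !=set0).

Definition strong_winning (R : realType) (I : cinterval R) (alpha : R)
    (S : set R) : Prop :=
  [/\ 0 < alpha < 1, S `<=` cset I &
   forall beta : R, 0 < beta < 1 ->
     exists sigma : strategy R, winning_strategy I alpha beta S sigma].

(* ** Points whose orbit closure misses [P] *)

Definition orbit_avoiding (R : realType) (f : R -> R) (P : set R) : set R :=
  [set x | 0 <= x <= 1 /\
           P `&` closure [set iter n f x | n in [set: nat]] = set0].

(* Main.v *)
Require Import Defs.
From mathcomp Require Import all_boot all_order all_algebra.
From mathcomp Require Import all_classical all_reals all_analysis.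
From mathcomp Require Import zify ring lra.
Set Implicit Arguments.
Unset Strict Implicit.
Unset Printing Implicit Defensive.
Import Order.TTheory GRing.Theory Num.Theory.
Import numFieldNormedType.Exports.
Local Open Scope classical_set_scope.
Local Open Scope ring_scope.

(** Why the theorem holds.

Let [g_0], [g_1] be the inverses of the two branches, both defined on
[[0, 1)], and for a word [w] in the letters 0, 1 let [w] also denote the
composite of the corresponding inverses.  Every orbit is coded by words: if
[f^m x < 1] then [x = w (f^m x)] for the word [w] of length [m] recording the
branches visited.  So the orbit of [x] stays away from [p] as soon as, for all
long [w], [x] keeps away from [w p] at a distance proportional to the size of
[w (p - delta, p + delta)], a neighbourhood of [w p] that [f^m] spreads over
[(p - delta, p + delta)].

Two estimates, uniform in the word, carry the argument.

- Bounded distortion ([bounded_distortion]).  On [[a, b]] inside [(0, 1)], the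
  difference quotients of all the maps [w] agree up to one factor.  The
  neutral fixed point is harmless for two reasons.  On the left branch [f'] is
  increasing, so the oscillations of [f'] along a stay near 0 telescope
  ([word_osc_zeros_le]).  Since [f''(x)] and [f''(y)] are comparable for
  comparable [x] and [y], their sum is moreover at most proportional to the
  length of the interval that starts the stay ([word_osc_zeros_linear]); these
  lengths decrease geometrically from one stay to the next, because [f] expands
  uniformly on the right branch.

- Cylinders shrink uniformly ([cylinders_shrink]): a long word contains either
  many letters 1 or a long run of letters 0, and [g_0^s] tends to 0 uniformly.

Fix [p] in [(0, 1)].  In the game with target [p], only one point has to be
avoided at each turn ([capture_unique]).  If an interval [B] lies in both
[w (p - delta, p + delta)] and [w' (p - delta, p + delta)] and has a size
comparable to both, with [w] the shorter word, then [w' = w v].  The two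
estimates bound the length of [v] independently of [delta], and [v p] is within
[3 delta] of [p].  Finitely many words [v] are involved, so if [delta] is small
then [v p = p], that is [w p = w' p].  When Alice keeps away from that point at
all turns of a sequence with bounded gaps, the first interval of the sequence
that fits into [w (p - delta, p + delta)] gives [x] the required distance from
[w p], for every long [w] ([avoidance_point]).

The endpoints 0 and 1 are approached only through the cut [r1]: an orbit that
never hits these fixed points and stays away from [r1] also stays away from
them, the left branch moving points up and the right branch moving them down
([orbit_away_from_fixed_points]).  So the targets are the points of [P], the
cut [r1], and, to treat the finitely many early times, the countably many exact
preimages [w q] of the points [q] of [P], 0, 1 and [r1].  Turn [k] serves the
target numbered by the 2-adic valuation of [k + 1], which leaves bounded gaps
between the turns serving a given target; Alice answers with the left or the
right quarter of Bob's interval, whichever is farther from the point to avoid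
([scheduled_wins]).  Hence [alpha = 1/4] works for every [f]. *)

(** * Inverse branches and words *)

(** Half-open pieces: each branch maps its piece bijectively onto [[0, 1)], so
    the codings of points are unique and cylinders are nested. *)
Definition piece (R : realType) (r1 : R) (c : bool) (x : R) : Prop :=
  if c then r1 <= x < 1 else 0 <= x < r1.

(** What the dynamical argument retains of the hypotheses on [f], with [d] for
    [f']: [tb_comparable] is the comparability of [f''] at comparable points of
    the left branch, in the integrated form that avoids a second derivative. *)
Record expanding_two_branch (R : realType) (r1 M kappa L K : R)
    (f d : R -> R) : Prop := {
  tb_r1 : 0 < r1 < 1 ;
  tb_kappa : 1 < kappa ;
  tb_L : 0 <= L ;
  tb_K : 0 <= K ;
  tb_f0 : f 0 = 0 ;
  tb_fr1 : f r1 = 0 ;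
  tb_f1 : f 1 = 1 ;
  tb_unit : forall x : R, 0 <= x < 1 -> 0 <= f x < 1 ;
  tb_onto : forall (c : bool) (y : R), 0 <= y < 1 ->
    exists2 x, piece r1 c x & f x = y ;
  tb_mvt_l : forall s t : R, 0 <= s -> s < t -> t < r1 ->
    exists2 xi, s < xi < t & f t - f s = d xi * (t - s) ;
  tb_mvt_r : forall s t : R, r1 <= s -> s < t -> t <= 1 ->
    exists2 xi, s < xi < t & f t - f s = d xi * (t - s) ;
  tb_dl_mono : forall s t : R, 0 <= s -> s <= t -> t < r1 -> d s <= d t ;
  tb_dl : forall t : R, 0 <= t < r1 -> 1 <= d t <= M ;
  tb_dl_gt1 : forall t : R, 0 < t < r1 -> 1 < d t ;
  tb_dr : forall t : R, r1 < t < 1 -> kappa <= d t ;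
  tb_lip : forall s t : R, r1 < s -> s <= t -> t < 1 ->
    `|d t - d s| <= L * (t - s) ;
  tb_comparable : forall x s t s' t' : R, 0 < x ->
    x <= s -> s < t -> t <= M * x -> t < r1 ->
    x <= s' -> s' < t' -> t' <= M * x -> t' < r1 ->
    (d t - d s) * (t' - s') <= K * (d t' - d s') * (t - s)
}.

Definition inv_branch (R : realType) (r1 : R) (f : R -> R) (c : bool) (y : R) :
    R :=
  xget 0 [set x | piece r1 c x /\ f x = y].

(** The head letter is applied last, so that [f] deletes it. *)
Fixpoint word_map (R : realType) (r1 : R) (f : R -> R) (w : seq bool) (u : R) :
    R :=
  if w is c :: w' then inv_branch r1 f c (word_map r1 f w' u) else u.

Section Words.
Context {R : realType} {r1 M kappa L K : R} {f d : R -> R}.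
Hypothesis H : expanding_two_branch r1 M kappa L K f d.

Local Notation g := (inv_branch r1 f).
Local Notation wd := (word_map r1 f).

Lemma r1_gt0 : 0 < r1. Proof. by case/andP: (tb_r1 H). Qed.
Lemma r1_lt1 : r1 < 1. Proof. by case/andP: (tb_r1 H). Qed.

Lemma piece_unit c (x : R) : piece r1 c x -> 0 <= x < 1.
Proof. by have := tb_r1 H; case: c => /= /andP[? ?] /andP[? ?]; lra. Qed.

Lemma inv_branchP c (y : R) : 0 <= y < 1 -> piece r1 c (g c y) /\ f (g c y) = y.
Proof.
move=> y01; rewrite /inv_branch; case: xgetP => [x -> //|] /=.
by have [x px fx] := tb_onto H c y01 => /(_ x) [].
Qed.

Lemma deriv_ge1 c (s t xi : R) : piece r1 c s -> piece r1 c t ->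
  s < xi < t -> 1 <= d xi.
Proof.
case: c => /= /andP[? ?] /andP[? ?] /andP[? ?].
  have /(tb_dr H) : r1 < xi < 1 by lra.
  by have := tb_kappa H; lra.
by have /(tb_dl H)/andP[] : 0 <= xi < r1 by lra.
Qed.

Lemma piece_mvt c (s t : R) : piece r1 c s -> piece r1 c t -> s < t ->
  exists2 xi, s < xi < t & f t - f s = d xi * (t - s).
Proof.
case: c => /= /andP[? ?] /andP[? ?] st.
  by apply: (tb_mvt_r H); lra.
by apply: (tb_mvt_l H); lra.
Qed.

Lemma piece_expand c (s t : R) : piece r1 c s -> piece r1 c t -> s <= t ->
  t - s <= f t - f s.
Proof.
move=> ps pt; rewrite le_eqVlt => /predU1P[->|st]; first by rewrite !subrr.
have [xi xiI ->] := piece_mvt ps pt st.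
have := deriv_ge1 ps pt xiI; nra.
Qed.

Lemma right_expand (s t : R) : piece r1 true s -> piece r1 true t -> s <= t ->
  kappa * (t - s) <= f t - f s.
Proof.
move=> ps pt; rewrite le_eqVlt => /predU1P[->|st].
  by rewrite !subrr mulr0.
have [xi xiI ->] := piece_mvt ps pt st.
have : r1 < xi < 1 by move: ps pt => /= /andP[? ?] /andP[? ?]; lra.
by move/(tb_dr H) => ?; rewrite ler_wpM2r// subr_ge0 ltW.
Qed.

Lemma piece_mono c (s t : R) : piece r1 c s -> piece r1 c t ->
  (f s <= f t) = (s <= t).
Proof.
move=> ps pt; apply/idP/idP => [fst|st].
  rewrite leNgt; apply/negP => ts.
  by have := piece_expand pt ps (ltW ts); lra.
by have := piece_expand ps pt st; lra.
Qed.

Lemma inv_branchK c (x : R) : piece r1 c x -> g c (f x) = x.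
Proof.
move=> px; have [pg fg] := inv_branchP c (tb_unit H (piece_unit px)).
by apply/eqP; rewrite eq_le -(piece_mono pg px) -(piece_mono px pg) fg lexx.
Qed.

Lemma piece_letter_inj c c' (x : R) : piece r1 c x -> piece r1 c' x -> c = c'.
Proof. by case: c c' => -[] //= /andP[? ?] /andP[? ?]; lra. Qed.

Lemma word_unit w (u : R) : 0 <= u < 1 -> 0 <= wd w u < 1.
Proof.
by move=> u01; elim: w => //= c w IH; apply: piece_unit (inv_branchP c IH).1.
Qed.

Lemma word_piece c w (u : R) : 0 <= u < 1 -> piece r1 c (wd (c :: w) u).
Proof. by move=> u01; have [] := inv_branchP c (word_unit w u01). Qed.

Lemma word_headK c w (u : R) : 0 <= u < 1 -> f (wd (c :: w) u) = wd w u.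
Proof. by move=> u01; have [] := inv_branchP c (word_unit w u01). Qed.

Lemma word_cat w1 w2 (u : R) : wd (w1 ++ w2) u = wd w1 (wd w2 u).
Proof. by elim: w1 => //= c w1 ->. Qed.

Lemma word_mono w (u v : R) : 0 <= u < 1 -> 0 <= v < 1 ->
  (wd w u <= wd w v) = (u <= v).
Proof.
move=> u01 v01; elim: w => //= c w IH.
have [pu fu] := inv_branchP c (word_unit w u01).
have [pv fv] := inv_branchP c (word_unit w v01).
by rewrite -IH -(piece_mono pu pv) fu fv.
Qed.

Lemma word_smono w (u v : R) : 0 <= u < 1 -> 0 <= v < 1 ->
  (wd w u < wd w v) = (u < v).
Proof. by move=> u01 v01; rewrite !ltNge word_mono. Qed.

Lemma word_inj w (u v : R) : 0 <= u < 1 -> 0 <= v < 1 ->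
  wd w u = wd w v -> u = v.
Proof.
move=> u01 v01 e; apply/eqP.
by rewrite eq_le -(word_mono w u01 v01) -(word_mono w v01 u01) e lexx.
Qed.

Lemma word_contract w (u v : R) : 0 <= u -> u <= v -> v < 1 ->
  wd w v - wd w u <= v - u.
Proof.
move=> u0 uv v1; have u01 : 0 <= u < 1 by lra.
have v01 : 0 <= v < 1 by lra.
elim: w => //= c w; apply: le_trans.
have [pu fu] := inv_branchP c (word_unit w u01).
have [pv fv] := inv_branchP c (word_unit w v01).
have -> : wd w v - wd w u = f (g c (wd w v)) - f (g c (wd w u)).
  by rewrite fu fv.
apply: (piece_expand pu pv).
by rewrite -(piece_mono pu pv) fu fv word_mono.
Qed.

(** The orbit can reach 1 only from 1 itself, so [f^m x < 1] keeps the first [m]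
    iterates in the domain of the coding. *)
Lemma word_itinerary m (x : R) : 0 <= x -> iter m f x < 1 -> x <= 1 ->
  exists2 w, size w = m & 0 <= iter m f x < 1 /\ x = wd w (iter m f x).
Proof.
elim: m x => [|m IH] x x0 fm1 x1.
  by move: fm1 => /= fm1; exists [::] => //=; split=> //; rewrite x0 fm1.
have xlt1 : x < 1.
  rewrite lt_neqAle x1 andbT; apply/eqP => xe; move: fm1.
  have -> : iter m.+1 f x = 1.
    by rewrite xe; elim: m.+1 => //= k ->; exact: tb_f1 H.
  by rewrite ltxx.
have x01 : 0 <= x < 1 by rewrite x0.
have /andP[fx0 fx1] := tb_unit H x01.
rewrite iterSr in fm1 *.
have [w sw [h xw]] := IH (f x) fx0 fm1 (ltW fx1).
have [xr|xr] := ltP x r1.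
- exists (false :: w); first by rewrite /= sw.
  by split=> //=; rewrite -xw (@inv_branchK false)//=; apply/andP.
- exists (true :: w); first by rewrite /= sw.
  by split=> //=; rewrite -xw (@inv_branchK true)//=; apply/andP.
Qed.

Lemma word_between w (s t x : R) : 0 <= s < 1 -> 0 <= t < 1 ->
  wd w s <= x <= wd w t -> exists2 u, s <= u <= t & x = wd w u.
Proof.
move=> s01 t01; elim: w x => /= [|c w IH] x; first by exists x.
have [ps fs] := inv_branchP c (word_unit w s01).
have [pt ft] := inv_branchP c (word_unit w t01).
move=> /andP[sx xt].
have px : piece r1 c x.
  move: ps pt; rewrite /piece.
  move: (c) (inv_branch _ _ _ _) sx (inv_branch _ _ _ _) xt.
  by case=> y sx z xt /andP[? ?] /andP[? ?]; apply/andP; split; lra.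
have /IH [u ust fx] : wd w s <= f x <= wd w t.
  by rewrite -{1}fs -ft (piece_mono ps px) (piece_mono px pt) sx.
by exists u => //; rewrite -fx inv_branchK.
Qed.

(** Cylinders are nested or disjoint: the first letter can be read off from the
    piece that contains the point, and [f] removes it. *)
Lemma word_prefix w w' (u u' : R) : 0 <= u < 1 -> 0 <= u' < 1 ->
  (size w <= size w')%N -> wd w u = wd w' u' -> exists w'', w' = w ++ w''.
Proof.
move=> u01 u01'; elim: w w' => [|c w IH] [|c' w'] //=;
  [by exists [::]|by exists (c' :: w')|].
rewrite ltnS => sw e.
have [pu fu] := inv_branchP c (word_unit w u01).
have [pu' fu'] := inv_branchP c' (word_unit w' u01').
have cc' : c = c' by apply: piece_letter_inj pu _; rewrite e.
have [|w'' ->] := IH w' sw; first by rewrite -fu -fu' e.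
by exists w''; rewrite cc'.
Qed.

End Words.

(** * Oscillation of the derivative along a word *)

(** A bound for the oscillation of [d] on [[x, y]]: on the left piece [d] is
    monotone, and on the right piece it is [L]-Lipschitz.  Keeping the exact
    difference on the left is what makes sums over a stay telescope. *)
Definition deriv_osc (R : realType) (r1 L : R) (d : R -> R) (x y : R) : R :=
  if y < r1 then d y - d x else L * (y - x).

(** The sum of these oscillations over the images of [[a, b]] under all nonempty
    suffixes of [w]: it bounds the logarithm of the distortion of [w] on
    [[a, b]]. *)
Fixpoint word_osc (R : realType) (r1 L : R) (f d : R -> R) (w : seq bool)
    (a b : R) : R :=
  if w is _ :: w' then
    word_osc r1 L f d w' a b +
    deriv_osc r1 L d (word_map r1 f w a) (word_map r1 f w b)
  else 0.

Section Distortion.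
Context {R : realType} {r1 M kappa L K : R} {f d : R -> R}.
Hypothesis H : expanding_two_branch r1 M kappa L K f d.

Local Notation wd := (word_map r1 f).
Local Notation zeros k := (nseq k false).
Local Notation osc := (deriv_osc r1 L d).
Local Notation E := (word_osc r1 L f d).

Lemma word_osc_cat w1 w2 (a b : R) :
  E (w1 ++ w2) a b = E w2 a b + E w1 (wd w2 a) (wd w2 b).
Proof.
elim: w1 => /= [|c w1 ->]; first by rewrite addr0.
by rewrite addrA !word_cat.
Qed.

Lemma slope_bound_ge1 : 1 <= M.
Proof.
have r0 := r1_gt0 H.
have /(tb_dl H)/andP[h1 h2] : 0 <= (0 : R) < r1 by apply/andP; split.
exact: le_trans h1 h2.
Qed.

Lemma deriv_le_osc c (x y s t : R) : piece r1 c x -> piece r1 c y ->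
  x < s < y -> x < t < y -> d t <= d s + osc x y.
Proof.
rewrite /deriv_osc.
case: c => /= /andP[x0 x1] /andP[y0 y1] /andP[xs sy] /andP[xt ty].
  rewrite ltNge y0/=; have := tb_L H.
  case/orP: (le_total s t) => st L0.
    have := tb_lip H (le_lt_trans x0 xs) st (lt_trans ty y1).
    rewrite ler_norml => /andP[_]; nra.
  have := tb_lip H (le_lt_trans x0 xt) st (lt_trans sy y1).
  rewrite ler_norml => /andP[]; nra.
rewrite y1.
have := tb_dl_mono H (le_trans x0 (ltW xt)) (ltW ty) y1.
have := tb_dl_mono H x0 (ltW xs) (lt_trans sy y1); lra.
Qed.

(** By the mean value theorem each letter multiplies a ratio of increments by a
    ratio [d xi' / d xi] of slopes; as [d >= 1], this is at most
    [1 + osc <= exp osc]. *)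
Lemma word_osc_distortion w (a b u v u' v' : R) : 0 <= a -> b < 1 ->
  a <= u -> u < v -> v <= b -> a <= u' -> u' < v' -> v' <= b ->
  (wd w v - wd w u) * (v' - u') <=
  expR (E w a b) * (wd w v' - wd w u') * (v - u).
Proof.
move=> a0 b1 au uv vb au' uv' vb'.
elim: w => [|c w IH]; first by rewrite /= expR0 mul1r mulrC.
have a01 : 0 <= a < 1 by lra.
have b01 : 0 <= b < 1 by lra.
have u01 : 0 <= u < 1 by lra.
have v01 : 0 <= v < 1 by lra.
have u01' : 0 <= u' < 1 by lra.
have v01' : 0 <= v' < 1 by lra.
have pw (z : R) := @word_piece _ _ _ _ _ _ _ _ H c w z.
have wm (y z : R) (hy : 0 <= y < 1) (hz : 0 <= z < 1) :=
  word_mono H (c :: w) hy hz.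
have ws (y z : R) (hy : 0 <= y < 1) (hz : 0 <= z < 1) :=
  word_smono H (c :: w) hy hz.
have [xi xiI] := piece_mvt H (pw u u01) (pw v v01)
  (etrans (ws u v u01 v01) uv).
have [xi' xiI'] := piece_mvt H (pw u' u01') (pw v' v01')
  (etrans (ws u' v' u01' v01') uv').
rewrite !(word_headK H) // => e' e.
have dxi := deriv_ge1 H (pw u u01) (pw v v01) xiI.
have au1 : wd (c :: w) a <= wd (c :: w) u by rewrite wm.
have vb1 : wd (c :: w) v <= wd (c :: w) b by rewrite wm.
have au1' : wd (c :: w) a <= wd (c :: w) u' by rewrite wm.
have vb1' : wd (c :: w) v' <= wd (c :: w) b by rewrite wm.
have uv1' : wd (c :: w) u' < wd (c :: w) v' by rewrite ws.
have osc_le : d xi' <= d xi + osc (wd (c :: w) a) (wd (c :: w) b).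
  by apply: (deriv_le_osc (pw a a01) (pw b b01)); lra.
have osc_ge0 : 0 <= osc (wd (c :: w) a) (wd (c :: w) b).
  have : d xi <= d xi + osc (wd (c :: w) a) (wd (c :: w) b).
    by apply: (deriv_le_osc (pw a a01) (pw b b01)); lra.
  by rewrite lerDl.
rewrite [E _ _ _]/(E w a b + osc (wd (c :: w) a) (wd (c :: w) b)) expRD.
have := expR_ge1Dx (osc (wd (c :: w) a) (wd (c :: w) b)).
move: (osc _ _) osc_le osc_ge0 => o osc_le osc_ge0 exo.
move: IH; rewrite e e'.
have := expR_gt0 (E w a b); move: (expR (E w a b)) => eE eE0 IH.
have h : d xi' <= d xi * expR o.
  apply: le_trans osc_le _; apply: (@le_trans _ _ (d xi * (1 + o))).
    by rewrite mulrDr mulr1 lerD2l ler_peMl.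
  by rewrite ler_wpM2l//; lra.
have d0 : 0 < d xi by lra.
rewrite -(ler_pM2l d0) !mulrA; apply: le_trans IH _.
have -> : d xi * eE * expR o * (wd (c :: w) v' - wd (c :: w) u') * (v - u) =
  eE * ((d xi * expR o) * (wd (c :: w) v' - wd (c :: w) u')) * (v - u) by ring.
rewrite ler_wpM2r ?ler_wpM2l ?ler_wpM2r//; lra.
Qed.

Lemma word_zeros_piece k (u : R) : 0 <= u < 1 ->
  piece r1 false (wd (zeros k.+1) u).
Proof. exact: (word_piece H false (zeros k)). Qed.

Lemma deriv_osc_zeros w (a b : R) : 0 <= a < 1 -> 0 <= b < 1 ->
  osc (wd (false :: w) a) (wd (false :: w) b) =
  d (wd (false :: w) b) - d (wd (false :: w) a).
Proof.
move=> a01 b01; rewrite /deriv_osc.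
by have /andP[_ ->] := word_piece H false w b01.
Qed.

Lemma word_osc_zerosS k (a b : R) : 0 <= a < 1 -> 0 <= b < 1 ->
  E (zeros k.+1) a b = E (zeros k) a b +
    (d (wd (zeros k.+1) b) - d (wd (zeros k.+1) a)).
Proof. by move=> a01 b01; rewrite -deriv_osc_zeros. Qed.

End Distortion.

(** * Stays on the left branch *)

Section LeftStays.
Context {R : realType} {r1 M kappa L K : R} {f d : R -> R}.
Hypothesis H : expanding_two_branch r1 M kappa L K f d.

Local Notation wd := (word_map r1 f).
Local Notation zeros k := (nseq k false).
Local Notation E := (word_osc r1 L f d).

Lemma left_gain (x y : R) : 0 <= x -> x <= y -> y < r1 -> f x - x <= f y - y.
Proof.
move=> x0 xy yr.
have := @piece_expand _ _ _ _ _ _ _ _ H false x y.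
have h1 : piece r1 false x by apply/andP; split=> //; apply: le_lt_trans yr.
have h2 : piece r1 false y by apply/andP; split=> //; apply: le_trans xy.
by move=> /(_ h1 h2 xy); lra.
Qed.

Lemma left_gain_gt0 (x : R) : 0 < x < r1 -> 0 < f x - x.
Proof.
move=> /andP[x0 xr].
have [xi /andP[h1 h2]] := tb_mvt_l H (lexx 0) x0 xr.
rewrite (tb_f0 H) !subr0 => ->.
have /(tb_dl_gt1 H) h : 0 < xi < r1 by lra.
by nra.
Qed.

(** One step of [f] raises a point [y >= e] of the left piece by at least
    [f e - e], because the gain [f y - y] is nondecreasing; going backwards,
    each step loses that much until the orbit is below [e]. *)
Lemma zeros_cvg0 (eps : R) : 0 < eps ->
  exists s, forall b, 0 <= b < 1 -> wd (zeros s) b < eps.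
Proof.
move=> eps0; set e := Num.min eps (r1 / 2).
have r0 := r1_gt0 H.
have e0 : 0 < e by rewrite lt_min eps0 /=; lra.
have er : e < r1 by rewrite gt_min; apply/orP; right; lra.
have eta0 : 0 < f e - e by apply: left_gain_gt0; rewrite e0.
have claim s b : 0 <= b < 1 ->
    (wd (zeros s) b < e) || (wd (zeros s) b <= 1 - (f e - e) * s%:R).
  move=> b01; elim: s => [|s IH].
    by rewrite mulr0 subr0 /=; case/andP: b01 => _ /ltW ->; rewrite orbT.
  have [//|] := ltP (wd (zeros s.+1) b) e => /= ey.
  have /= /andP[y0 yr] := word_zeros_piece H s b01.
  have fy := word_headK H false (zeros s) b01; rewrite -/(zeros s.+1) in fy.
  have := left_gain (ltW e0) ey yr; rewrite fy => gain.
  move: IH; rewrite -natr1 => /orP[]; rewrite /= in gain ey *; lra.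
have [s hs] : exists s : nat, 1 <= (f e - e) * s%:R.
  exists (Num.bound (f e - e)^-1).
  rewrite -ler_pdivrMl// mulr1; apply: ltW.
  by apply: archi_boundP; rewrite invr_ge0 ltW.
exists s => b b01; have /orP[h|h] := claim s b b01.
  by apply: lt_le_trans h _; rewrite ge_min lexx.
have /andP[h1 _] := word_unit H (zeros s) b01.
have : wd (zeros s) b <= 0 by lra.
by lra.
Qed.

Lemma zeros_unit k (u : R) : 0 <= u < 1 -> 0 <= wd (zeros k) u < 1.
Proof. exact: (word_unit H). Qed.

Lemma zeros_shift k s (u : R) :
  wd (zeros k) (wd (zeros s) u) = wd (zeros (k + s)) u.
Proof. by rewrite nseqD (word_cat (r1 := r1) (f := f)). Qed.

Lemma deriv_zeros_bounds k (u : R) : 0 <= u < 1 ->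
  1 <= d (wd (zeros k.+1) u) <= M.
Proof. by move=> u01; apply: (tb_dl H); exact: (word_zeros_piece H). Qed.

(** The [k+s]-th image of [b] lies to the left of the [k]-th image of [a], so
    the sum is at most that of the differences of [d] between the [k]-th and the
    [k+s]-th image of [b].  It telescopes, up to [s] terms at each end. *)
Lemma word_osc_zeros_le s k (a b : R) : 0 <= a -> a <= b -> b < 1 ->
  wd (zeros s) b <= a -> E (zeros k) a b <= s%:R * (M - 1).
Proof.
move=> a0 ab b1 sb.
have a01 : 0 <= a < 1 by lra.
have b01 : 0 <= b < 1 by lra.
pose x i := d (wd (zeros i.+1) b).
have xb i : 1 <= x i <= M by exact: deriv_zeros_bounds.
suff claim : E (zeros k) a b <= \sum_(j < s) (x j - x (k + j)%N).
  apply: le_trans claim _.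
  rewrite -[s in s%:R]card_ord -sum1_card natr_sum mulr_suml.
  apply: ler_sum => j _; have := xb j; have := xb (k + j)%N.
  by rewrite mul1r; lra.
elim: k => [|k IH].
  by rewrite big1 // => j _; rewrite add0n subrr.
rewrite (word_osc_zerosS H) //.
have le_d : d (wd (zeros (k.+1 + s)) b) <= d (wd (zeros k.+1) a).
  rewrite -zeros_shift.
  have sb01 := zeros_unit s b01.
  have /= /andP[p0 p1] := word_zeros_piece H k sb01.
  have /= /andP[q0 q1] := word_zeros_piece H k a01.
  by apply: (tb_dl_mono H) => //; rewrite (word_mono H (zeros k.+1)).
have -> : \sum_(j < s) (x j - x (k.+1 + j)%N) =
    \sum_(j < s) (x j - x (k + j)%N) + (x k - x (k + s)%N).
  have -> : x k - x (k + s)%N = \sum_(j < s) (x (k + j)%N - x (k + j.+1)%N).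
    rewrite -(big_mkord xpredT (fun j => x (k + j)%N - x (k + j.+1)%N)).
    under eq_bigr do rewrite -opprB.
    by rewrite sumrN telescope_sumr // opprB addn0.
  rewrite -big_split /=; apply: eq_bigr => j _.
  by rewrite addSnnS; ring.
by apply: lerD => //; rewrite lerD2l lerN2 /x -addSn.
Qed.

Lemma left_slope_bound (x : R) : 0 <= x < r1 -> f x <= M * x.
Proof.
move=> /andP[]; rewrite le_eqVlt => /predU1P[<- _|x0 xr].
  by rewrite (tb_f0 H) mulr0.
have [xi /andP[h1 h2]] := tb_mvt_l H (lexx 0) x0 xr.
rewrite (tb_f0 H) !subr0 => ->.
have /(tb_dl H) /andP[_ h] : 0 <= xi < r1 by lra.
by rewrite ler_wpM2r // ltW.
Qed.

(** The intervals [g_0^j [a1, r1)], where [a1 = g_0 r1], tile [(0, r1)].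
    By bounded distortion of [g_0^j] on [[a1, r1]], which is the case [s = 1] of
    the preceding bound, the image of [[u, v]] occupies a proportion
    [O(v - u)] of its tile; by comparability of [f''] on a tile, it then also
    receives a proportion [O(v - u)] of the increment of [d] over the tile, and
    these increments telescope. *)
Lemma word_osc_zeros_linear : exists2 C, 0 <= C &
  forall k (u v : R), r1 <= u -> u <= v -> v < 1 ->
    E (zeros k) u v <= C * (v - u).
Proof.
have r0 := r1_gt0 H; have r_1 := r1_lt1 H; have M1 := slope_bound_ge1 H.
have L0 := tb_L H; have K0 := tb_K H.
have r01 : 0 <= r1 < 1 by lra.
pose a1 := wd (zeros 1) r1.
have /= /andP[a1_0 a1r] : piece r1 false a1.
  exact: (word_zeros_piece H 0 r01).
have fa1 : f a1 = r1 by exact: (word_headK H false [::] r01).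
have a1M : r1 <= M * a1.
  by rewrite -fa1; apply: left_slope_bound; apply/andP; split.
have a1_gt0 : 0 < a1 by nra.
have a101 : 0 <= a1 < 1 by lra.
(* At [r1] the value of [d] belongs to the right branch, so the left half of the
   first tile serves as the interval of comparison there. *)
pose m := (a1 + r1) / 2.
have m1 : a1 < m by rewrite /m; lra.
have m2 : m < r1 by rewrite /m; lra.
pose A0 := K * (d m - d a1) / (m - a1).
have dm : d a1 <= d m by apply: (tb_dl_mono H) => //; lra.
have A0_ge0 : 0 <= A0.
  by rewrite /A0 divr_ge0 ?mulr_ge0//; lra.
pose A1 := K * expR (M - 1) / (r1 - a1).
have A1_ge0 : 0 <= A1.
  by rewrite /A1 divr_ge0 ?mulr_ge0 ?expR_ge0//; lra.
exists (A0 + A1 * (M - 1)).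
  by apply: addr_ge0 => //; apply: mulr_ge0 => //; lra.
move=> k u v ru; rewrite le_eqVlt => /predU1P[<- u1|uv v1].
  rewrite subrr mulr0; elim: k => //= k IH.
  by rewrite -/(zeros k) /deriv_osc !subrr mulr0 if_same addr0.
have u01 : 0 <= u < 1 by lra.
have v01 : 0 <= v < 1 by lra.
pose u1 := wd (zeros 1) u; pose v1' := wd (zeros 1) v.
have /= /andP[u1_0 u1r] : piece r1 false u1.
  exact: (word_zeros_piece H 0 u01).
have /= /andP[v1_0 v1r] : piece r1 false v1'.
  exact: (word_zeros_piece H 0 v01).
have u101 : 0 <= u1 < 1 by lra.
have v101 : 0 <= v1' < 1 by lra.
have uv1 : u1 < v1' by rewrite (word_smono H (zeros 1)).
have au1 : a1 <= u1 by rewrite (word_mono H (zeros 1)).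
have uv_contract : v1' - u1 <= v - u.
  by apply: (word_contract H (zeros 1)) => //; lra.
pose dr j := d (wd (zeros j.+1) r1).
have drb j : 1 <= dr j <= M by exact: deriv_zeros_bounds.
suff claim : E (zeros k.+1) u v <= (A0 + A1 * (dr 0 - dr k)) * (v1' - u1).
  have Ek : E (zeros k) u v <= E (zeros k.+1) u v.
    rewrite (word_osc_zerosS H) // lerDl subr_ge0.
    have /= /andP[p0 p1] := word_zeros_piece H k u01.
    have /= /andP[q0 q1] := word_zeros_piece H k v01.
    by apply: (tb_dl_mono H) => //; rewrite (word_mono H (zeros k.+1))// ltW.
  apply: (le_trans Ek); apply: (le_trans claim).
  have b0 := drb 0; have bk := drb k.
  have h1 : 0 <= A0 + A1 * (M - 1).
    by apply: addr_ge0 => //; apply: mulr_ge0 => //; lra.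
  have h2 : 0 <= v1' - u1 by lra.
  apply: (@le_trans _ _ ((A0 + A1 * (M - 1)) * (v1' - u1))).
    by rewrite ler_wpM2r // lerD2l ler_wpM2l//; lra.
  by rewrite ler_wpM2l.
elim: k => [|k IH].
  rewrite (word_osc_zerosS H) // add0r subrr mulr0 addr0 -/u1 -/v1'.
  have ma : 0 < m - a1 by lra.
  rewrite /A0 mulrAC ler_pdivlMr //.
  by apply: (tb_comparable H) a1_gt0 _ _ _ _ _ _ _ _ => //; lra.
set w := zeros k.+1.
have wu : wd (zeros k.+2) u = wd w u1 by rewrite zeros_shift addn1.
have wv : wd (zeros k.+2) v = wd w v1' by rewrite zeros_shift addn1.
have wa : wd (zeros k.+2) r1 = wd w a1 by rewrite zeros_shift addn1.
have dist := @word_osc_distortion _ _ _ _ _ _ _ _ H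
  w a1 r1 u1 v1' a1 r1 a1_0 r_1 au1 uv1
  (ltW v1r) (lexx _) a1r (lexx _).
have EM : E w a1 r1 <= M - 1.
  by rewrite -[M - 1]mul1r; apply: (@word_osc_zeros_le 1) => //; lra.
have /andP[wa0 war] : 0 <= wd w a1 < r1 := word_zeros_piece H k a101.
have /andP[wr0 wrr] : 0 <= wd w r1 < r1 := word_zeros_piece H k r01.
have wa_gt0 : 0 < wd w a1.
  have : wd w 0 < wd w a1 by rewrite (word_smono H) //; lra.
  have /andP[h _] := word_unit H w (u := 0) ltac:(lra).
  lra.
have cmp : (d (wd w v1') - d (wd w u1)) * (wd w r1 - wd w a1) <=
    K * (d (wd w r1) - d (wd w a1)) * (wd w v1' - wd w u1).
  have Mw : wd w r1 <= M * wd w a1.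
    rewrite -wa.
    have <- : f (wd (zeros k.+2) r1) = wd w r1 by exact: (word_headK H).
    by apply: left_slope_bound; rewrite wa; apply/andP; split.
  apply: (tb_comparable H) wa_gt0 _ _ _ _ _ _ _ _ => //.
  - by rewrite (word_mono H).
  - by rewrite (word_smono H).
  - by apply: le_trans Mw; rewrite (word_mono H) // ltW.
  - by apply: le_lt_trans wrr; rewrite -/w (word_mono H) // ltW.
  - by rewrite (word_smono H) //.
have wra : 0 < wd w r1 - wd w a1 by rewrite subr_gt0 (word_smono H).
have drk : dr k.+1 = d (wd w a1) by rewrite /dr wa.
have drk' : dr k = d (wd w r1) by [].
rewrite (word_osc_zerosS H k.+1 u01 v01) wu wv drk -/w.
move: IH; rewrite drk' -/w => IH.
have dd : d (wd w a1) <= d (wd w r1).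
  by apply: (tb_dl_mono H) => //; rewrite (word_mono H)// ltW.
suff : d (wd w v1') - d (wd w u1) <=
    A1 * (d (wd w r1) - d (wd w a1)) * (v1' - u1) by lra.
rewrite -(ler_pM2r wra); apply: (le_trans cmp).
have ra : 0 < r1 - a1 by lra.
rewrite -(ler_pM2r ra).
have -> : A1 * (d (wd w r1) - d (wd w a1)) * (v1' - u1) * (wd w r1 - wd w a1)
    * (r1 - a1) = K * (d (wd w r1) - d (wd w a1)) *
      (expR (M - 1) * (wd w r1 - wd w a1) * (v1' - u1)).
  by rewrite /A1; field; lra.
rewrite -[leLHS](mulrA (K * _)) ler_wpM2l //; first by rewrite mulr_ge0//; lra.
apply: (le_trans dist).
rewrite ler_wpM2r ?ler_wpM2r ?ler_expR//; lra.
Qed.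

End LeftStays.

(** * Bounded distortion and uniform contraction *)

Section BoundedDistortion.
Context {R : realType} {r1 M kappa L K : R} {f d : R -> R}.
Hypothesis H : expanding_two_branch r1 M kappa L K f d.

Local Notation wd := (word_map r1 f).
Local Notation zeros k := (nseq k false).
Local Notation E := (word_osc r1 L f d).

(** Cut [w] at its letters 1.  The stay that follows an interval [J] of the
    right piece costs at most [C |J|], the next letter 1 costs [L |J'|] where
    [J'] is its image, and [kappa |J'| <= |J|].  So [E + A |J|], with [A] as
    below, does not increase from one letter 1 to the next.  The first stay
    starts from [[a, b]] and costs at most [S]. *)
Lemma word_osc_bounded (a b : R) : 0 < a -> a <= b -> b < 1 ->
  exists E0, forall w, E w a b <= E0.
Proof.
move=> a0 ab b1.
have M1 := slope_bound_ge1 H; have L0 := tb_L H; have k1 := tb_kappa H.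
have a01 : 0 <= a < 1 by lra.
have b01 : 0 <= b < 1 by lra.
have [C C0 HC] := word_osc_zeros_linear H.
have [s hs] := zeros_cvg0 H a0.
pose A := (kappa * C + L) / (kappa - 1).
have A0 : 0 <= A by apply: divr_ge0; nra.
have AE : A * kappa = A + kappa * C + L by rewrite /A; field; lra.
pose S := s%:R * (M - 1).
have S0 : 0 <= S by rewrite mulr_ge0//; lra.
pose E1 := S + L + A.
have zeros_ab k : E (zeros k) a b <= S.
  by apply: (word_osc_zeros_le H) => //; [exact: ltW|exact: ltW (hs b b01)].
have claim w : exists k w1, w = zeros k ++ w1 /\
    (w1 = [::] \/ (exists w2, w1 = true :: w2) /\
      E w1 a b + A * (wd w1 b - wd w1 a) <= E1).
  elim: w => [|[] w0 [k [w1 [-> hw1]]]].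
  - by exists 0, [::]; split=> //; left.
  - exists 0, (true :: zeros k ++ w1); split=> //; right; split.
      by exists (zeros k ++ w1).
    set w := zeros k ++ w1.
    have /andP[ra _] : r1 <= wd (true :: w) a < 1 := word_piece H true w a01.
    have /andP[rb _] : r1 <= wd (true :: w) b < 1 := word_piece H true w b01.
    have -> : E (true :: w) a b =
        E w a b + L * (wd (true :: w) b - wd (true :: w) a).
      by rewrite /= /deriv_osc ltNge rb.
    have abw : wd (true :: w) a <= wd (true :: w) b by rewrite (word_mono H).
    have := right_expand H
      (word_piece H true w a01) (word_piece H true w b01) abw.
    rewrite !(word_headK H) //; set J' := _ - wd (true :: w) a => kJ'.
    have J'0 : 0 <= J' by rewrite subr_ge0.
    have Jc := word_contract H w (ltW a0) ab b1.
    have Ew : E w a b = E w1 a b + E (zeros k) (wd w1 a) (wd w1 b).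
      by rewrite word_osc_cat.
    case: hw1 => [w1E|[[w2 w1E] hE]].
      have Ew' : E w a b <= S by rewrite Ew w1E add0r; exact: zeros_ab.
      have J'1 : J' <= 1 by nra.
      have : (L + A) * J' <= L + A by rewrite ler_piMr//; lra.
      rewrite /E1; lra.
    have wa1 := word_unit H w1 a01; have wb1 := word_unit H w1 b01.
    have wab1 : wd w1 a <= wd w1 b by rewrite (word_mono H).
    have J2 : wd w b - wd w a <= wd w1 b - wd w1 a.
      rewrite /w !word_cat; apply: (word_contract H) => //.
        by case/andP: wa1.
      by case/andP: wb1.
    have Ek : E (zeros k) (wd w1 a) (wd w1 b) <= C * (wd w1 b - wd w1 a).
      apply: HC => //; last by case/andP: wb1.
      by have := word_piece H true w2 a01; rewrite -w1E => /= /andP[].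
    move: hE Ek J2; set J := wd w1 b - _ => hE Ek J2.
    have AC : 0 <= A - C by nra.
    have : (A - C) * (kappa * J') <= (A - C) * J.
      by rewrite ler_wpM2l//; lra.
    rewrite Ew; nra.
  - by exists k.+1, w1; split.
exists (E1 + C) => w; have [k [w1 [-> hw1]]] := claim w.
rewrite word_osc_cat; case: hw1 => [->|[[w2 w1E] hE]].
  by rewrite add0r; apply: le_trans (zeros_ab k) _; rewrite /E1; lra.
have /andP[wa1 _] := word_unit H w1 a01.
have /andP[_ wb1] := word_unit H w1 b01.
have wab1 : wd w1 a <= wd w1 b by rewrite (word_mono H).
have Ek : E (zeros k) (wd w1 a) (wd w1 b) <= C * (wd w1 b - wd w1 a).
  apply: HC => //.
  by have := word_piece H true w2 a01; rewrite -w1E => /= /andP[].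
nra.
Qed.

Lemma bounded_distortion (a b : R) : 0 < a -> a <= b -> b < 1 ->
  exists2 D, 1 <= D & forall w (u v u' v' : R),
    a <= u -> u <= v -> v <= b -> a <= u' -> u' <= v' -> v' <= b ->
    (wd w v - wd w u) * (v' - u') <= D * (wd w v' - wd w u') * (v - u).
Proof.
move=> a0 ab b1; have [E0 hE0] := word_osc_bounded a0 ab b1.
have E00 : 0 <= E0 := hE0 [::].
exists (expR E0); first by rewrite -expR0 ler_expR.
move=> w u v u' v' au uv vb au' uv' vb'.
have mono : wd w u' <= wd w v' by rewrite (word_mono H) //; lra.
have := uv; rewrite le_eqVlt => /predU1P[->|uv1].
  by rewrite !subrr mul0r mulr0.
have := uv'; rewrite le_eqVlt => /predU1P[->|uv1'].
  by rewrite !subrr !mulr0 mul0r.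
apply: le_trans (word_osc_distortion H w (ltW a0) b1 au uv1 vb au' uv1' vb') _.
rewrite ler_wpM2r ?ler_wpM2r ?ler_expR//; lra.
Qed.

(** A word of length [n * s.+1] contains [s] consecutive letters 0, and then
    maps [[0, 1)] into an interval shorter than [eps], or [n] letters 1, and
    then contracts by [kappa ^ n]. *)
Lemma cylinders_shrink (eps : R) : 0 < eps -> exists N, forall w u v,
  (N <= size w)%N -> 0 <= u -> u <= v -> v < 1 -> wd w v - wd w u <= eps.
Proof.
move=> eps0; have [s hs] := zeros_cvg0 H eps0; have k1 := tb_kappa H.
have claim n w (u v : R) :
    (n * s.+1 <= size w)%N -> 0 <= u -> u <= v -> v < 1 ->
    (wd w v - wd w u <= eps) || (kappa ^+ n * (wd w v - wd w u) <= 1).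
  move=> + u0 uv v1.
  have u01 : 0 <= u < 1 by lra.
  have v01 : 0 <= v < 1 by lra.
  elim: n w => [|n IH] w sw.
    apply/orP; right; rewrite expr0 mul1r.
    by apply: le_trans (word_contract H w u0 uv v1) _; lra.
  have split_zeros m w' : (m <= size w')%N -> (exists w2, w' = zeros m ++ w2) \/
      exists j w2, w' = zeros j ++ true :: w2 /\ (j < m)%N.
    elim: m w' => [|m IHm] [|[] w'] // h; first by left; exists [::].
    - by left; exists (true :: w').
    - by left; exists (false :: w').
    - by right; exists 0, w'.
    - have [[w2 ->]|[j [w2 [-> jm]]]] := IHm w' h; first by left; exists w2.
      by right; exists j.+1, w2.
  have [|[w2 wE]|[j [w2 [wE jm]]]] := split_zeros s w.
  - by apply: leq_trans sw; rewrite mulSn (leq_trans _ (leq_addr _ _)).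
  - apply/orP; left; rewrite wE !word_cat.
    have := hs _ (word_unit H w2 v01).
    by have /andP[] := word_unit H (zeros s) (word_unit H w2 u01); lra.
  - have sw2 : (n * s.+1 <= size w2)%N.
      move: sw; rewrite wE size_cat size_nseq /= mulSn addSn addnS ltnS => sw.
      rewrite -(leq_add2l s); apply: leq_trans sw _.
      by rewrite leq_add2r ltnW.
    have u02 := word_unit H w2 u01; have v02 := word_unit H w2 v01.
    have uvt : wd (true :: w2) u <= wd (true :: w2) v by rewrite (word_mono H).
    have := right_expand H
      (word_piece H true w2 u01) (word_piece H true w2 v01) uvt.
    rewrite !(word_headK H) // => ek.
    have ec : wd w v - wd w u <= wd (true :: w2) v - wd (true :: w2) u.
      rewrite wE !word_cat; apply: (word_contract H) => //.
        by case/andP: (word_unit H (true :: w2) u01).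
      by case/andP: (word_unit H (true :: w2) v01).
    move: ek ec uvt.
    move: (wd (true :: w2) u) (wd (true :: w2) v) => p q ek ec uvt.
    have pq : q - p <= kappa * (q - p) by rewrite ler_peMl//; lra.
    have /orP[h|h] := IH w2 sw2; apply/orP; [left|right].
      by apply: le_trans ec (le_trans pq (le_trans ek h)).
    apply: le_trans h; rewrite exprSr -mulrA ler_wpM2l ?exprn_ge0//; first lra.
    by apply: le_trans ek; rewrite ler_wpM2l//; lra.
have [n hn] : exists n, 1 <= eps * kappa ^+ n.
  exists (Num.bound (eps^-1 / (kappa - 1))).
  set n := Num.bound _.
  have h : eps^-1 / (kappa - 1) < n%:R.
    apply: archi_boundP; apply: divr_ge0; last lra.
    by rewrite invr_ge0 ltW.
  (* Bernoulli's inequality *)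
  have : 1 + (kappa - 1) * n%:R <= kappa ^+ n.
    elim: (n) => [|m IHm]; first by rewrite expr0 mulr0 addr0.
    rewrite exprS -natr1.
    have : 0 <= m%:R :> R by [].
    move: (m%:R) (kappa ^+ m) IHm => x y IHm x0.
    have h1 : kappa * (1 + (kappa - 1) * x) <= kappa * y.
      by rewrite ler_wpM2l//; lra.
    have h2 : 0 <= (kappa - 1) ^+ 2 * x by rewrite mulr_ge0 ?sqr_ge0.
    by lra.
  rewrite ltr_pdivrMr in h; last lra.
  move=> bern; rewrite -ler_pdivrMl// mulr1; apply: le_trans bern.
  by rewrite mulrC; lra.
exists (n * s.+1)%N => w u v sw u0 uv v1.
have /orP[//|h] := claim n w u v sw u0 uv v1.
have k0 : 0 < kappa ^+ n by rewrite exprn_gt0//; lra.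
rewrite -(ler_pM2l k0); apply: le_trans h _; lra.
Qed.

End BoundedDistortion.

(** * One point to avoid at each scale *)

Lemma words_gap (R : realType) N (h : seq bool -> R) : exists2 e, 0 < e &
  forall w, (size w < N)%N -> h w != 0 -> e <= `|h w|.
Proof.
elim: N h => [|N IH] h; first by exists 1.
have [e1 e10 H1] := IH (fun w => h (true :: w)).
have [e2 e20 H2] := IH (fun w => h (false :: w)).
pose e0 := if h [::] == 0 then 1 else `|h [::]|.
exists (Num.min e0 (Num.min e1 e2)).
  rewrite !lt_min e10 e20 !andbT /e0.
  by case: eqP => // /eqP h0; rewrite normr_gt0.
move=> [|[] w] /= sw hw; rewrite !ge_min.
- by rewrite /e0 (negPf hw) lexx.
- by rewrite H1 ?orbT.
- by rewrite H2 ?orbT.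
Qed.

(** The point [x] is the outcome of intervals [[a j, b j]] shrinking at a
    controlled rate, and at each of them it was kept away from the point that
    [z] designates: what a player obtains at the turns devoted to one target. *)
Definition served (R : realType) (z : R -> R -> R) (lam c x : R) : Prop :=
  exists a b : nat -> R, [/\ forall j, a j < b j,
    forall j, a j <= x <= b j,
    forall j, lam * (b j - a j) <= b j.+1 - a j.+1,
    forall e, 0 < e -> exists j, b j - a j < e &
    forall j, c * (b j - a j) <= `|x - z (a j) (b j)|].

(** The case to be handled when [[a, b]] is Bob's interval: it lies in the
    neighbourhood of [word_map w p] that the word pulls back from
    [[p - delta, p + delta]], at the scale of that neighbourhood. *)
Definition captures (R : realType) (r1 : R) (f : R -> R) (p delta tau : R)
    (w : seq bool) (a b : R) : Prop :=
  [/\ word_map r1 f w (p - delta) <= a, b <= word_map r1 f w (p + delta) &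
      tau * (word_map r1 f w (p + delta) - word_map r1 f w (p - delta)) <=
      b - a].

Section Avoidance.
Context {R : realType} {r1 M kappa L K : R} {f d : R -> R}.
Hypothesis H : expanding_two_branch r1 M kappa L K f d.

Local Notation wd := (word_map r1 f).

(** With [w' = w v], the interval [[a, b]] is large in both pullbacks, so [v]
    multiplies the length of [[p - delta, p + delta]] by at least [tau / D], and
    that of [[A, B]] by at least [tau / D ^ 2].  Long words contract more than
    this, so [v] belongs to a finite set that depends on [p] and [tau] only.
    Hence [delta] can be chosen so that [v p] is either [p] or farther than
    [3 delta] from it. *)
Lemma capture_unique (p tau : R) : 0 < p < 1 -> 0 < tau ->
  exists2 delta0, 0 < delta0 & forall delta, 0 < delta <= delta0 ->
  forall w w' (a b : R), a < b ->
    captures r1 f p delta tau w a b -> captures r1 f p delta tau w' a b ->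
    wd w p = wd w' p.
Proof.
move=> p01 tau0; pose A := p / 2; pose B := (1 + p) / 2.
have A0 : 0 < A by rewrite /A; lra.
have AB : A <= B by rewrite /A /B; lra.
have B1 : B < 1 by rewrite /B; lra.
have [D D1 HD] := bounded_distortion H A0 AB B1.
have D0 : 0 < D by lra.
pose eN := (B - A) * tau / (2 * D ^+ 2).
have eN0 : 0 < eN.
  by rewrite /eN !(divr_gt0, mulr_gt0, exprn_gt0)// /A /B; lra.
have [N HN] := cylinders_shrink H eN0.
have [e1 e10 gap] := words_gap N (fun w => wd w p - p).
exists (Num.min (e1 / 4) (Num.min (p / 8) ((1 - p) / 8))).
  by rewrite !lt_min; apply/and3P; split; lra.
move=> delta /andP[delta0]; rewrite !le_min => /and3P[de1 dp dp1].
have s01 : 0 <= p - delta < 1 by lra.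
have t01 : 0 <= p + delta < 1 by lra.
have p01' : 0 <= p < 1 by lra.
have st : p - delta < p + delta by lra.
have width : p + delta - (p - delta) = 2 * delta by ring.
have pA : A <= p - 3 * delta by rewrite /A; lra.
have pB : p + 3 * delta <= B by rewrite /B; lra.
have dA : A <= p - delta by clear -H pA delta0; lra.
have dB : p + delta <= B by clear -H pB delta0; lra.
have BA : 0 < B - A by rewrite /A /B; lra.
suff claim w w' (a b : R) : (size w <= size w')%N -> a < b ->
    captures r1 f p delta tau w a b -> captures r1 f p delta tau w' a b ->
    wd w p = wd w' p.
  move=> w w' a b ab cw cw'; case/orP: (leq_total (size w) (size w')) => s.
    exact: claim cw cw'.
  by apply/esym; exact: claim cw' cw.
move=> sw ab [wa wb wl] [wa' wb' wl'].
(* [a] is read in both codings, as [w u] and as [w' u']. *)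
have [u /andP[u1 u2] au] := word_between H s01 t01
  (introT andP (conj wa (ltW (lt_le_trans ab wb)))).
have [u' /andP[u1' u2'] au'] := word_between H s01 t01
  (introT andP (conj wa' (ltW (lt_le_trans ab wb')))).
have u01 : 0 <= u < 1 by clear -H u1 u2 s01 t01; lra.
have u01' : 0 <= u' < 1 by clear -H u1' u2' s01 t01; lra.
have [v w'E] := word_prefix H u01 u01' sw (etrans (esym au) au').
rewrite w'E !word_cat in wa' wb' wl' au' *.
have vu' := word_inj H (word_unit H v u01') u01 (etrans (esym au') au).
have v1 : wd v (p - delta) <= u by rewrite -vu' (word_mono H).
have v2 : u <= wd v (p + delta) by rewrite -vu' (word_mono H).
have vlen := word_contract H v (proj1 (andP s01)) (ltW st) (proj2 (andP t01)).
rewrite width in vlen.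
set y0 := wd v (p - delta) in v1 vlen wa' wl' *.
set y1 := wd v (p + delta) in v2 vlen wb' wl' *.
have h1 : tau * (wd w (p + delta) - wd w (p - delta)) <= wd w y1 - wd w y0.
  exact: le_trans wl (lerB wb' wa').
have Wpos : 0 < wd w (p + delta) - wd w (p - delta).
  by rewrite subr_gt0 (word_smono H).
have yA : A <= y0 by clear -H pA v2 vlen u1; lra.
have yB : y1 <= B by clear -H pB v1 vlen u2; lra.
have h2 := HD w y0 y1 (p - delta) (p + delta) yA (le_trans v1 v2) yB
  dA (ltW st) dB.
rewrite width in h2.
have h3 : tau * (2 * delta) <= D * (y1 - y0).
  rewrite -(ler_pM2r Wpos).
  have -> : tau * (2 * delta) * (wd w (p + delta) - wd w (p - delta)) =
    tau * (wd w (p + delta) - wd w (p - delta)) * (2 * delta) by ring.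
  apply: (@le_trans _ _ ((wd w y1 - wd w y0) * (2 * delta))).
    by rewrite ler_wpM2r// mulr_ge0// ltW.
  by apply: le_trans h2 _; rewrite mulrAC.
have h4 := HD v (p - delta) (p + delta) A B dA (ltW st) dB (lexx _) AB (lexx _).
rewrite -/y0 -/y1 width in h4.
have [Nv|vN] := leqP N (size v).
  have h5 := HN v A B Nv (ltW A0) AB B1.
  have h6 : D * (y1 - y0) * (B - A) <= D * (D * eN * (2 * delta)).
    rewrite -mulrA ler_wpM2l ?(ltW D0)//; apply: (le_trans h4).
    apply: ler_wpM2r; first by rewrite mulr_ge0 ?ltW.
    by apply: ler_wpM2l; first exact: ltW.
  have h7 : tau * (2 * delta) * (B - A) <= D * (y1 - y0) * (B - A).
    by rewrite ler_wpM2r// ltW.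
  have h8 : D * (D * eN * (2 * delta)) = tau * delta * (B - A).
    by rewrite /eN; clear -H D0; field; lra.
  have h9 : 0 < tau * delta * (B - A) by rewrite !mulr_gt0.
  by clear -H h6 h7 h8 h9; lra.
have [vp|vp] := eqVneq (wd v p - p) 0.
  by move/subr0_eq: vp => ->.
have := gap v vN vp.
have q1 : y0 <= wd v p by rewrite (word_mono H)// gerBl ltW.
have q2 : wd v p <= y1 by rewrite (word_mono H)// lerDl ltW.
have : `|wd v p - p| <= 3 * delta.
  by rewrite ler_norml; clear -H q1 q2 v1 v2 u1 u2 vlen; lra.
by clear -H de1 delta0; lra.
Qed.

(** Let [x = w u] with [u = f^m x] close to [p], and consider the first interval
    inside [w [p - delta, p + delta]].  Its predecessor contains [x] and sticks
    out, so by bounded distortion neither of the two is much shorter than that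
    neighbourhood.  The point to avoid is then [w p], and distance from it in
    proportion to the neighbourhood means distance of [u] from [p]. *)
Lemma avoidance_point (p lam c : R) : 0 < p < 1 -> 0 < lam -> 0 < c ->
  exists z : R -> R -> R, forall x, 0 <= x <= 1 -> served z lam c x ->
  exists2 eps, 0 < eps & exists m0, forall m, (m0 <= m)%N ->
    eps <= `|iter m f x - p|.
Proof.
move=> p01 lam0 c0; pose A := p / 2; pose B := (1 + p) / 2.
have A0 : 0 < A by rewrite /A; lra.
have AB : A <= B by rewrite /A /B; lra.
have B1 : B < 1 by rewrite /B; lra.
have [D D1 HD] := bounded_distortion H A0 AB B1.
have D0 : 0 < D by lra.
(* Half of the neighbourhood separates [x] from its ends, up to the distortion
   [D] and the factor [lam] lost in passing to the next interval. *)
pose tau := lam / (4 * D).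
have tau0 : 0 < tau by rewrite divr_gt0// mulr_gt0.
have [delta0 delta00 uniq] := capture_unique p01 tau0.
pose delta := Num.min delta0 (Num.min (p / 4) ((1 - p) / 4)).
have delta_gt0 : 0 < delta by rewrite !lt_min delta00 /=; lra.
have [dd0 dp dp1] : [/\ delta <= delta0, delta <= p / 4 & delta <= (1 - p) / 4].
  by rewrite !ge_min !lexx !orbT.
have {}uniq := uniq delta (introT andP (conj delta_gt0 dd0)).
have s01 : 0 <= p - delta < 1 by clear -H dp dp1 p01 delta_gt0; lra.
have t01 : 0 <= p + delta < 1 by clear -H dp dp1 p01 delta_gt0; lra.
have p01' : 0 <= p < 1 by lra.
have sp : p - delta < p by rewrite gtrBl.
have pt : p < p + delta by rewrite ltrDl.
have st := lt_trans sp pt.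
have width : p + delta - (p - delta) = 2 * delta by ring.
have dA : A <= p - delta by rewrite /A; clear -H dp p01; lra.
have dB : p + delta <= B by rewrite /B; clear -H dp1 p01; lra.
pose cap := captures r1 f p delta tau.
exists (fun a b => wd (xget [::] [set w | cap w a b]) p) => x x01
  [a [b [ab xab ratio small far]]].
have [N HN] : exists N, forall w u v, (N <= size w)%N -> 0 <= u -> u <= v ->
    v < 1 -> wd w v - wd w u <= (b 0%N - a 0%N) / 2.
  by apply: (cylinders_shrink H); have := ab 0%N; lra.
pose eps := Num.min (delta / 2) (c * tau * delta / D).
have eps0 : 0 < eps.
  by rewrite lt_min !(divr_gt0, mulr_gt0)//.
(* [m] is so large that the initial interval does not fit into the neighbourhood
   and the first one that does has a predecessor. *)
exists eps => //; exists N => m Nm; rewrite leNgt; apply/negP => close.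
have [close1 close2] : `|iter m f x - p| < delta / 2 /\
    `|iter m f x - p| <= c * tau * delta / D.
  by move: close; rewrite lt_min => /andP[? /ltW ?].
move: close1; rewrite ltr_norml => /andP[cl1 cl2].
have um1 : iter m f x < 1 by clear -H cl2 dp1 p01 delta_gt0; lra.
have [x0 x1] := andP x01.
have [w sw [u01 xE]] := word_itinerary H x0 um1 x1.
move: (iter m f x) close close2 cl1 cl2 um1 u01 xE.
move=> u close close2 cl1 cl2 um1 u01 xE.
pose l := wd w (p - delta); pose r := wd w (p + delta).
have su : p - delta < u by clear -H cl1 delta_gt0; lra.
have ut : u < p + delta by clear -H cl2 delta_gt0; lra.
have Au := le_trans dA (ltW su); have uB := le_trans (ltW ut) dB.
have lx : l < x by rewrite xE (word_smono H).
have xr : x < r by rewrite xE (word_smono H).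
have ex : exists j, (l <= a j) && (b j <= r).
  have [|j hj] := small (Num.min (x - l) (r - x)).
    by rewrite lt_min !subr_gt0 lx.
  move: hj; rewrite lt_min => /andP[h1 h2].
  by exists j; have := xab j; clear -H h1 h2; lra.
case: (ex_minnP ex) => j /andP[la br] jmin.
have lr : r - l <= (b 0%N - a 0%N) / 2.
  by apply: HN; [rewrite sw|case/andP: s01|exact: ltW|case/andP: t01].
case: j => [|k] in la br jmin *.
  by have := ab 0%N; clear -H la br lr; lra.
have hd1 := HD w (p - delta) (p + delta) (p - delta) u
  dA (ltW st) dB dA (ltW su) uB.
have hd2 := HD w (p - delta) (p + delta) u (p + delta)
  dA (ltW st) dB Au (ltW ut) dB.
rewrite -/l -/r -xE width in hd1 hd2.
have rl0 : 0 < r - l by rewrite subr_gt0 (lt_trans lx).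
have xl : r - l <= 4 * D * (x - l).
  rewrite -(ler_pM2r delta_gt0).
  have : (r - l) * (delta / 2) <= (r - l) * (u - (p - delta)).
    by rewrite ler_wpM2l ?(ltW rl0)//; clear -H cl1; lra.
  by clear -H hd1; lra.
have rx : r - l <= 4 * D * (r - x).
  rewrite -(ler_pM2r delta_gt0).
  have : (r - l) * (delta / 2) <= (r - l) * (p + delta - u).
    by rewrite ler_wpM2l ?(ltW rl0)//; clear -H cl2; lra.
  by clear -H hd2; lra.
have big : r - l <= 4 * D * (b k - a k).
  have /negP : ~~ ((l <= a k) && (b k <= r)).
    by apply/negP => /jmin; rewrite ltnn.
  have [h1 h2] := andP (xab k).
  have D40 : 0 <= 4 * D by rewrite mulr_ge0 ?ltW.
  move/negP; rewrite negb_and -!ltNge => /orP[h|h].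
    by apply: le_trans xl _; rewrite ler_wpM2l//; clear -H h h2; lra.
  by apply: le_trans rx _; rewrite ler_wpM2l//; clear -H h h1; lra.
have capw : cap w (a k.+1) (b k.+1).
  split=> //; rewrite -/l -/r; apply: le_trans (ratio k).
  rewrite /tau mulrAC ler_pdivrMr ?mulr_gt0//.
  rewrite -mulrA; apply: ler_wpM2l; first exact: ltW.
  by rewrite mulrC.
have zE : wd (xget [::] [set w | cap w (a k.+1) (b k.+1)]) p = wd w p.
  by case: xgetP => [v _ capv|/(_ w)//]; exact: uniq capv capw.
have := far k.+1; rewrite zE => farw.
have [_ _ caplen] := capw; rewrite -/l -/r in caplen.
have hc : c * (tau * (r - l)) <= `|x - wd w p|.
  by apply: le_trans farw; rewrite ler_wpM2l// ltW.
have hu : `|x - wd w p| * (2 * delta) <= D * (r - l) * `|u - p|.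
  rewrite xE; case: (leP p u) => pu.
    rewrite !ger0_norm ?subr_ge0 ?(word_mono H)// -width.
    exact: (HD w p u (p - delta) (p + delta)
      (le_trans dA (ltW sp)) pu uB dA (ltW st) dB).
  rewrite !ltr0_norm ?subr_lt0 ?(word_smono H)// !opprB -width.
  exact: (HD w u p (p - delta) (p + delta)
    Au (ltW pu) (le_trans (ltW pt) dB) dA (ltW st) dB).
have h1 : D * (r - l) * `|u - p| <= D * (r - l) * (c * tau * delta / D).
  by rewrite ler_wpM2l// mulr_ge0// ltW.
have h2 : D * (r - l) * (c * tau * delta / D) = c * (tau * (r - l)) * delta.
  by clear -H D0; field; lra.
have h3 : c * (tau * (r - l)) * (2 * delta) <= `|x - wd w p| * (2 * delta).
  by rewrite ler_wpM2r// mulr_ge0// ltW.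
have h4 : 0 < c * (tau * (r - l)) * delta by do ?[apply: mulr_gt0 => //].
by clear -H h1 h2 h3 h4 hu; lra.
Qed.

(** On the left piece [f y >= y], and on the right piece beyond [r1 + e] one has
    [f y >= f (r1 + e)]; symmetrically for upper bounds.  So the bounds by the
    value at time [m0] and by [f (r1 + e)], [f (r1 - e)] propagate. *)
Lemma orbit_away_from_fixed_points (x eps : R) (m0 : nat) : 0 <= x <= 1 ->
  (forall m, iter m f x != 0) -> (forall m, iter m f x != 1) -> 0 < eps ->
  (forall m, (m0 <= m)%N -> eps <= `|iter m f x - r1|) ->
  exists2 eta, 0 < eta & forall m, (m0 <= m)%N ->
    eta <= iter m f x <= 1 - eta.
Proof.
move=> x01 x_0 x_1 eps0 away.
have r0 := r1_gt0 H; have r_1 := r1_lt1 H.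
have orb m : 0 < iter m f x < 1.
  rewrite !lt_neqAle [0 == _]eq_sym x_0 x_1 /=.
  elim: m => [//|m /andP[h0 h1]] /=.
  have /andP[? ?] : 0 <= f (iter m f x) < 1.
    by apply: (tb_unit H); rewrite h0 lt_neqAle x_1.
  by apply/andP; split=> //; exact: ltW.
pose e := Num.min eps (Num.min (r1 / 2) ((1 - r1) / 2)).
have e0 : 0 < e by rewrite !lt_min eps0 /=; lra.
have [e1 e2 e3] : [/\ e <= eps, e <= r1 / 2 & e <= (1 - r1) / 2].
  by rewrite !ge_min !lexx !orbT.
pose lb := f (r1 + e); pose ub := f (r1 - e).
have pr1 : piece r1 true r1 by apply/andP; split.
have pr1e : piece r1 true (r1 + e) by apply/andP; split; lra.
have pr1e' : piece r1 false (r1 - e) by apply/andP; split; lra.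
have lb0 : 0 < lb.
  by have := piece_expand H pr1 pr1e; rewrite (tb_fr1 H) /lb; lra.
have ub1 : ub < 1.
  by have /(tb_unit H)/andP[] := piece_unit H pr1e'.
have sides m : (m0 <= m)%N -> iter m f x <= r1 - e \/ r1 + e <= iter m f x.
  move=> /away; have [h|h] := leP r1 (iter m f x).
    by rewrite ger0_norm ?subr_ge0// => ?; right; lra.
  by rewrite ltr0_norm ?subr_lt0// opprB => ?; left; lra.
pose y := iter m0 f x.
have bounds m : (m0 <= m)%N ->
    Num.min y lb <= iter m f x /\ iter m f x <= Num.max y ub.
  move=> /subnK <-; elim: (m - m0)%N => [|k [IH1 IH2]].
    by rewrite add0n ge_min lexx le_max lexx.
  rewrite addSn iterS; have := sides (k + m0)%N (leq_addl _ _).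
  have /andP[z0 z1] := orb (k + m0)%N.
  move: (iter (k + m0) f x) IH1 IH2 z0 z1 => z IH1 IH2 z0 z1 [zr|zr].
    have pz : piece r1 false z by apply/andP; split; lra.
    split.
      apply: le_trans IH1 _.
      have := @left_gain_gt0 _ _ _ _ _ _ _ _ H z.
      by lra.
    have : f z <= ub by rewrite /ub (piece_mono H pz pr1e').
    by move=> h; rewrite le_max h orbT.
  have pz : piece r1 true z by apply/andP; split; lra.
  split.
    have : lb <= f z by rewrite /lb (piece_mono H pr1e pz).
    by move=> h; rewrite ge_min h orbT.
  apply: le_trans IH2.
  have [|xi /andP[xi1 xi2]] := tb_mvt_r H (_ : r1 <= z) z1 (lexx 1); first lra.
  rewrite (tb_f1 H) => e1z.
  have : kappa <= d xi by apply: (tb_dr H); lra.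
  have := tb_kappa H; nra.
have /andP[y0 y1] := orb m0.
exists (Num.min (Num.min y lb) (1 - Num.max y ub)).
  by rewrite !lt_min y0 lb0 subr_gt0 gt_max y1 ub1.
move=> m /bounds[h1 h2]; apply/andP; split.
  by apply: le_trans h1; rewrite ge_min lexx.
apply: le_trans h2 _; rewrite lerBrDr -lerBrDl.
by rewrite ge_min lexx orbT.
Qed.

End Avoidance.

(** * One-sided derivatives and the mean value theorem *)

Lemma within_quotientE (R : realType) (D : set R) (f : R -> R) (x : R) :
  nbhs x D ->
  (fun y => (f y - f x) / (y - x)) @ within D x^' =
  (fun h => h^-1 *: ((f \o shift x) (h *: 1) - f x)) @ (0 : R)^'.
Proof.
move=> nD; apply/seteqP; split => P /=.
- move=> HP0.
  have HP1 : \forall y \near x, y != x -> D y ->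
      P ((f y - f x) / (y - x)) := HP0.
  have HP : \forall y \near x, y != x -> P ((f y - f x) / (y - x)).
    by apply: filterS2 _ HP1 nD => y h Dy yx; exact: h.
  move: HP; rewrite (near_shift 0) subr0 /=; apply: filterS => h /= hP h0.
  rewrite /GRing.scale /= mulr1 mulrC.
  have := hP; rewrite addrK; apply.
  by rewrite -subr_eq0 addrK.
- move=> HP0.
  have HP : \forall h \near (0 : R), h != 0 ->
      P (h^-1 *: ((f \o shift x) (h *: 1) - f x)) := HP0.
  suff : \forall y \near x, y != x -> D y -> P ((f y - f x) / (y - x)) by [].
  rewrite (near_shift 0) subr0 /=; apply: filterS HP => h /= hP hx _.
  have h0 : h != 0 by move: hx; rewrite -subr_eq0 addrK.
  by have := hP h0; rewrite /GRing.scale /= mulr1 mulrC addrK.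
Qed.

Lemma derive_withinE (R : realType) (D : set R) (f : R -> R) (x : R) :
  nbhs x D -> derive_within D f x = 'D_1 f x.
Proof. by move=> nD; rewrite /derive_within within_quotientE. Qed.

Lemma derivable_withinE (R : realType) (D : set R) (f : R -> R) (x : R) :
  nbhs x D -> derivable_within D f x = derivable f x 1.
Proof. by move=> nD; rewrite /derivable_within within_quotientE. Qed.

Lemma derivable_within_approx (R : realType) (D : set R) (f : R -> R) (x : R) :
  derivable_within D f x -> forall e, 0 < e ->
  \forall y \near x, D y -> y != x ->
    `|derive_within D f x - (f y - f x) / (y - x)| < e.
Proof.
move=> /cvgrPdist_lt df e e0.
have near_x : \forall y \near x, y != x -> D y ->
    `|derive_within D f x - (f y - f x) / (y - x)| < e := df e e0.
by apply: filterS near_x => y h Dy yx; exact: h.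
Qed.

Lemma derivable_within_cvg (R : realType) (D : set R) (f : R -> R) (x : R) :
  derivable_within D f x -> f @ within D (nbhs x) --> f x.
Proof.
move=> df; have := derivable_within_approx df ltr01.
set l := derive_within D f x => approx.
apply/cvgrPdist_lt => e e0.
suff : \forall y \near x, D y -> `|f x - f y| < e by [].
have C0 : 0 < `|l| + 1 by rewrite ltr_wpDl.
near=> y => Dy.
have [->|yx] := eqVneq y x; first by rewrite subrr normr0.
have h : `|l - (f y - f x) / (y - x)| < 1.
  by move: Dy yx; near: y; exact: approx.
have yxe : `|x - y| < e / (`|l| + 1).
  near: y; apply/nbhs_ballP; exists (e / (`|l| + 1)); first exact: divr_gt0.
  by move=> z.
have q : `|(f y - f x) / (y - x)| < `|l| + 1.
  have : `|(f y - f x) / (y - x)| <= `|l| + `|(f y - f x) / (y - x) - l|.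
    by rewrite -{1}(subrKC l ((f y - f x) / (y - x))) ler_normD.
  rewrite (distrC _ l); lra.
have -> : f x - f y = (f y - f x) / (y - x) * (x - y).
  by field; rewrite subr_eq0.
rewrite normrM; apply: (@le_lt_trans _ _ ((`|l| + 1) * `|x - y|)).
  by rewrite ler_wpM2r// ltW.
by rewrite mulrC -ltr_pdivlMr.
Unshelve. all: by end_near. Qed.

Lemma derivable_within_is_derive (R : realType) (D : set R) (f : R -> R)
    (x : R) : nbhs x D -> derivable_within D f x ->
  is_derive x 1 f (derive_within D f x).
Proof.
move=> nD dx; apply: DeriveDef; first by rewrite -(derivable_withinE f nD).
by rewrite (derive_withinE f nD).
Qed.

Lemma within_mvt (R : realType) (D : set R) (f : R -> R) (s t : R) : s < t ->
  `[s, t]%classic `<=` D -> (forall x, D x -> derivable_within D f x) ->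
  exists2 xi, s < xi < t & f t - f s = derive_within D f xi * (t - s).
Proof.
move=> st stD df.
have [||xi xiI ->] := @MVT _ f (derive_within D f) s t st.
- move=> x xst; apply: derivable_within_is_derive; last first.
    apply/df/stD; exact: subset_itv_oo_cc xst.
  apply: (filterS stD); apply: filterS (near_in_itvoo xst) => y.
  exact: subset_itv_oo_cc.
- apply/subspace_continuousP => x /= xst.
  apply: cvg_trans (derivable_within_cvg (df _ (stD _ xst))).
  apply: cvg_app; exact: within_subset.
by exists xi => //; move: xiI; rewrite in_itv.
Qed.

Lemma powR_comparable (R : realType) (M gam x y : R) : 1 <= M -> 0 < x ->
  0 < y -> x <= M * y -> y <= M * x -> x `^ gam <= M `^ `|gam| * y `^ gam.
Proof.
move=> M1 x0 y0 xy yx.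
have M0 : 0 < M by lra.
have [g0|g0] := leP 0 gam.
  rewrite ger0_norm// -powRM ?(ltW M0) ?(ltW y0)//.
  by apply: (ge0_ler_powR g0) => //; rewrite nnegrE ltW// mulr_gt0.
rewrite ltr0_norm//; have g0' : 0 <= - gam by lra.
have : y `^ (- gam) <= (M * x) `^ (- gam).
  by apply: (ge0_ler_powR g0') => //; rewrite nnegrE ltW// mulr_gt0.
rewrite powRM ?(ltW M0) ?(ltW x0)// !powRN => h.
have X : 0 < x `^ gam by exact: powR_gt0.
have Y : 0 < y `^ gam by exact: powR_gt0.
have Z : 0 < M `^ gam by exact: powR_gt0.
move: h; rewrite -invfM lef_pV2 ?posrE ?mulr_gt0// => h.
by rewrite ler_pdivlMl.
Qed.

(** * Manneville-Pomeau maps are expanding two-branch maps *)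

Section FromMP.
Context {R : realType} {r1 : R} {f : R -> R}.
Hypothesis H : MP_conditions r1 f.

Local Notation d := (bderive r1 f).
Local Notation dd := (bderive r1 (bderive r1 f)).

Lemma mp_r1_gt0 : 0 < r1. Proof. by case/andP: (mp_r1 H). Qed.
Lemma mp_r1_lt1 : r1 < 1. Proof. by case/andP: (mp_r1 H). Qed.

Lemma branch_left (x : R) : x < r1 -> branch r1 x = `[0, r1[%classic.
Proof. by rewrite /branch => ->. Qed.

Lemma branch_right (x : R) : r1 <= x -> branch r1 x = `[r1, 1]%classic.
Proof. by rewrite /branch ltNge => ->. Qed.

Lemma mp_mvt_left (s t : R) : 0 <= s -> s < t -> t < r1 ->
  exists2 xi, s < xi < t & f t - f s = d xi * (t - s).
Proof.
move=> s0 st tr.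
have [||xi /andP[h1 h2] e] := within_mvt (D := `[0, r1[%classic) (f := f) st.
- move=> x /=; rewrite !in_itv /=; lra.
- exact: (mp_C1 H).1.
exists xi; first by rewrite h1.
by rewrite /bderive branch_left// (lt_trans h2).
Qed.

Lemma mp_mvt_right (s t : R) : r1 <= s -> s < t -> t <= 1 ->
  exists2 xi, s < xi < t & f t - f s = d xi * (t - s).
Proof.
have r0 := mp_r1_gt0; have r_1 := mp_r1_lt1.
move=> s0 st tr.
have [||xi /andP[h1 h2] e] := within_mvt (D := `[r1, 1]%classic) (f := f) st.
- move=> x /=; rewrite !in_itv /=; lra.
- move=> x /=; rewrite in_itv /= => /andP[h1 h2].
  have : bderivable r1 f x by apply: (mp_derivable H); lra.
  by rewrite /bderivable branch_right.
exists xi; first by rewrite h1.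
by rewrite /bderive branch_right// (le_trans s0)// ltW.
Qed.

Let smooth : set R := `]0, r1[%classic `|` `]r1, 1]%classic.

Lemma nbhs_smooth (x : R) : 0 < x < r1 \/ r1 < x < 1 ->
  nbhs x smooth /\ nbhs x (branch r1 x).
Proof.
case=> xI.
- have near_x : \forall z \near x, z \in `]0, r1[.
    by apply: near_in_itvoo; rewrite in_itv.
  case/andP: xI => x0 xr; rewrite branch_left//.
  split; apply: filterS near_x => z.
    by left.
  by rewrite /= !in_itv /=; lra.
- have near_x : \forall z \near x, z \in `]r1, 1[.
    by apply: near_in_itvoo; rewrite in_itv.
  case/andP: xI => x0 xr; rewrite branch_right ?ltW//.
  split; apply: filterS near_x => z.
    by rewrite in_itv /= => /andP[h1 h2]; right; rewrite /= in_itv /= h1 ltW.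
  by rewrite /= !in_itv /=; lra.
Qed.

(** Near an interior point of a piece, the derivative relative to the smooth
    part and the derivative inside the branch are both the ordinary
    derivative. *)
Lemma mp_second_derivative (x : R) : 0 < x < r1 \/ r1 < x < 1 ->
  is_derive x 1 d (dd x).
Proof.
move=> xI; have [nS nB] := nbhs_smooth xI.
have dS : derivable (derive_within smooth f) x 1.
  rewrite -(derivable_withinE _ nS); apply: (mp_C2 H).2.1.
  exact: nbhs_singleton nS.
have eqd : \near x, derive_within smooth f x = d x.
  have xI' : \forall z \near x, 0 < z < r1 \/ r1 < z < 1.
    case: xI => xI.
      have : \forall z \near x, z \in `]0, r1[.
        by apply: near_in_itvoo; rewrite in_itv.
      by apply: filterS => z; rewrite in_itv /=; left.
    have : \forall z \near x, z \in `]r1, 1[.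
      by apply: near_in_itvoo; rewrite in_itv.
    by apply: filterS => z; rewrite in_itv /=; right.
  apply: filterS xI' => z /nbhs_smooth[nzS nzB].
  by rewrite /bderive !derive_withinE.
apply: DeriveDef; first exact: near_eq_derivable eqd dS.
by rewrite [in RHS]/bderive derive_withinE.
Qed.

Lemma mp_deriv_mvt_left (s t : R) : 0 <= s -> s < t -> t < r1 ->
  exists2 xi, s < xi < t & d t - d s = dd xi * (t - s).
Proof.
move=> s0 st tr; have [||xi xiI ->] := @MVT _ d dd s t st.
- move=> x; rewrite in_itv /= => xst; apply: mp_second_derivative; left; lra.
- have sub : `[s, t]%classic `<=` `[0, r1[%classic.
    by move=> x /=; rewrite !in_itv /=; lra.
  apply: (subspace_eq_continuous _ (continuous_subspaceW sub (mp_C1 H).2)).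
  move=> x; rewrite inE /= in_itv /= => xst.
  suff : derive_within `[0, r1[%classic f x = d x by [].
  by rewrite /bderive branch_left//; lra.
by exists xi => //; move: xiI; rewrite in_itv.
Qed.

Lemma mp_deriv_mvt_right (s t : R) : r1 < s -> s < t -> t < 1 ->
  exists2 xi, s < xi < t & d t - d s = dd xi * (t - s).
Proof.
move=> s0 st tr.
have dI x : s <= x <= t -> is_derive x 1 d (dd x).
  by move=> xst; apply: mp_second_derivative; right; lra.
have [||xi xiI ->] := @MVT _ d dd s t st.
- by move=> x; rewrite in_itv /= => xst; apply: dI; lra.
- by apply: derivable_within_continuous => x; rewrite in_itv /= => /dI[].
by exists xi => //; move: xiI; rewrite in_itv.
Qed.

(** The difference quotients at [s] converge to [d s] and are values of [d] at
    interior points; this makes [d] continuous at the endpoints of the right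
    piece. *)
Lemma mp_right_approx (s e : R) : r1 <= s <= 1 -> 0 < e ->
  exists2 xi, r1 < xi < 1 & `|xi - s| <= e /\ `|d s - d xi| <= e.
Proof.
have r0 := mp_r1_gt0; have r_1 := mp_r1_lt1.
move=> /andP[rs s1] e0.
have ds : derivable_within `[r1, 1]%classic f s.
  have : bderivable r1 f s by apply: (mp_derivable H); lra.
  by rewrite /bderivable branch_right.
have /nbhs_ballP[eta /= eta0 near_s] := derivable_within_approx ds e0.
pose m := Num.min (eta / 2) (Num.min e ((1 - r1) / 2)).
have m0 : 0 < m by rewrite !lt_min e0 /=; lra.
have [m1 m2 m3] : [/\ m <= eta / 2, m <= e & m <= (1 - r1) / 2].
  by rewrite !ge_min !lexx !orbT.
have bds : d s = derive_within `[r1, 1]%classic f s.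
  by rewrite /bderive branch_right.
have [sm|sm] := leP s ((1 + r1) / 2).
- have st : s < s + m by lra.
  have [xi /andP[x1 x2] e1] := mp_mvt_right rs st ltac:(lra).
  exists xi; first lra.
  split; first by rewrite ler_norml; lra.
  have := near_s (s + m); rewrite /ball /= e1 -bds => h; apply: ltW.
  have -> : d xi = d xi * (s + m - s) / (s + m - s) by field; lra.
  apply: h; last by apply/eqP; lra.
    by rewrite ltr_norml; lra.
  by rewrite in_itv /=; lra.
- have st : s - m < s by lra.
  have rsm : r1 <= s - m by lra.
  have [xi /andP[x1 x2] e1] := mp_mvt_right rsm st s1.
  exists xi; first lra.
  split; first by rewrite ler_norml; lra.
  have := near_s (s - m); rewrite /ball /= -bds => h; apply: ltW.
  have -> : d xi = (f (s - m) - f s) / (s - m - s).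
    have -> : f (s - m) - f s = - (f s - f (s - m)) by ring.
    by rewrite e1; field; lra.
  apply: h; last by apply/eqP; lra.
    by rewrite ltr_norml; lra.
  by rewrite in_itv /=; lra.
Qed.

Lemma mp_right_lipschitz : exists2 L, 0 <= L & forall s t,
  r1 <= s <= 1 -> r1 <= t <= 1 -> `|d s - d t| <= L * `|s - t|.
Proof.
have r0 := mp_r1_gt0; have r_1 := mp_r1_lt1.
have [L0 L0P] := mp_ddf_bounded H.
pose L := Num.max L0 0.
have Lge0 : 0 <= L by rewrite le_max lexx orbT.
have ddL x : r1 < x < 1 -> `|dd x| <= L.
  move=> /andP[x1 x2]; rewrite le_max; apply/orP; left; apply: L0P.
  by exists x => //=; rewrite in_itv /= x1 ltW.
have lip s t : r1 < s < 1 -> r1 < t < 1 -> `|d s - d t| <= L * `|s - t|.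
  wlog st : s t / s < t.
    move=> wl sI tI; have [st|ts|->] := ltgtP s t; first exact: wl.
      by rewrite distrC (distrC s); exact: wl.
    by rewrite !subrr normr0 mulr0.
  move=> /andP[s0 s1] /andP[t0 t1].
  have [xi /andP[x1 x2] e] := mp_deriv_mvt_right s0 st t1.
  rewrite distrC e normrM (distrC s) ler_wpM2r//; apply: ddL; lra.
exists L => // s t sI tI; apply/ler_addgt0Pr => e e0.
pose e' := e / (2 + 2 * L).
have e'0 : 0 < e' by rewrite divr_gt0//; lra.
have [xs xsI [s1 s2]] := mp_right_approx sI e'0.
have [xt xtI [t1 t2]] := mp_right_approx tI e'0.
have := lip xs xt xsI xtI.
have hh : `|xs - xt| <= `|s - t| + 2 * e'.
  have -> : xs - xt = (xs - s) + (s - t) - (xt - t) by ring.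
  by apply: le_trans (ler_normB _ _) _; have := ler_normD (xs - s) (s - t); lra.
have -> : d s - d t = (d s - d xs) + (d xs - d xt) - (d t - d xt) by ring.
move=> hl; apply: le_trans (ler_normB _ _) _.
have hN := ler_normD (d s - d xs) (d xs - d xt).
have : L * `|xs - xt| <= L * (`|s - t| + 2 * e') by rewrite ler_wpM2l.
have eE : e = 2 * e' + L * (2 * e') by rewrite /e'; field; lra.
by rewrite [in X in _ -> _ <= X]eE; lra.
Qed.

(** On the compact interval [[r1, 1]] one has [|d| > 1] and [d] is continuous,
    hence of constant sign, which is positive since [f r1 = 0] and [f 1 = 1]. *)
Lemma mp_right_expand : exists2 kappa, 1 < kappa & forall t, r1 <= t <= 1 ->
  kappa <= d t.
Proof.
have r0 := mp_r1_gt0; have r_1 := mp_r1_lt1.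
have [L L0 lip] := mp_right_lipschitz.
have cont : {within `[r1, 1], continuous d}.
  apply/subspace_continuousP => x /=; rewrite in_itv /= => xI.
  apply/cvgrPdist_lt => e e0.
  suff : \forall y \near x, `[r1, 1]%classic y -> `|d x - d y| < e by [].
  have e'0 : 0 < e / (L + 1) by rewrite divr_gt0//; lra.
  apply/nbhs_ballP; exists (e / (L + 1)) => // y; rewrite /ball /= => xy.
  rewrite in_itv /= => yI; apply: le_lt_trans (lip x y xI yI) _.
  rewrite ltr_pdivlMr in xy; last lra.
  have [->|xy0] := eqVneq x y; first by rewrite subrr normr0 mulr0.
  have : 0 < `|x - y| by rewrite normr_gt0 subr_eq0.
  by lra.
have gt1 x : r1 <= x <= 1 -> 1 < `|d x|.
  by move=> xI; apply: (mp_expand H); lra.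
have [c cI cmin] := EVT_min (ltW r_1) cont.
rewrite in_itv /= in cI.
have [xi xiI e] := mp_mvt_right (lexx r1) r_1 (lexx 1).
have xi_pos : 0 < d xi.
  move: e; rewrite (mp_f1 H) (mp_fr1 H) subr0 => e.
  have : 0 < d xi * (1 - r1) by rewrite -e.
  by rewrite pmulr_lgt0//; lra.
have c_pos : 0 < d c.
  rewrite ltNge; apply/negP => c_neg.
  have absurd (u v : R) : r1 <= u -> u <= v -> v <= 1 ->
      Num.min (d u) (d v) <= 0 <= Num.max (d u) (d v) -> False.
    move=> ru uv v1 mm.
    have sub : `[u, v]%classic `<=` `[r1, 1]%classic.
      by move=> x /=; rewrite !in_itv /=; lra.
    have [z] := IVT uv (continuous_subspaceW sub cont) mm.
    rewrite in_itv /= => zI dz.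
    have : 1 < `|d z| by apply: gt1; lra.
    by rewrite dz normr0 ltr10.
  have [cx|cx] := leP c xi.
    apply: (absurd c xi); [lra|lra|lra|].
    by rewrite ge_min c_neg le_max (ltW xi_pos) orbT.
  apply: (absurd xi c); [lra|lra|lra|].
  by rewrite ge_min c_neg orbT le_max (ltW xi_pos).
exists (d c); first by have := gt1 c cI; rewrite gtr0_norm.
by move=> t tI; apply: cmin; rewrite in_itv.
Qed.

Lemma mp_second_pos (x : R) : 0 < x < r1 -> 0 < dd x.
Proof.
move=> xI; have [C [gam [C1 g0 hC]]] := mp_ddf_order H.
have /andP[h _] := hC x xI.
have X : 0 < x `^ (gam - 1) by apply: powR_gt0; case/andP: xI.
move: h; rewrite ler_pdivlMr// => h; apply: lt_le_trans h.
by rewrite mulr_gt0// invr_gt0; lra.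
Qed.

Lemma mp_deriv_left_mono (s t : R) : 0 <= s -> s <= t -> t < r1 -> d s <= d t.
Proof.
move=> s0; rewrite le_eqVlt => /predU1P[->//|st] tr.
have [xi /andP[x1 x2] e] := mp_deriv_mvt_left s0 st tr.
rewrite -subr_ge0 e; apply: ltW; rewrite mulr_gt0 ?subr_gt0//.
by apply: mp_second_pos; lra.
Qed.

Lemma mp_second_comparable (M : R) : 1 <= M -> exists2 K, 0 <= K &
  forall x y, 0 < x < r1 -> 0 < y < r1 -> x <= M * y -> y <= M * x ->
    dd x <= K * dd y.
Proof.
move=> M1; have [C [gam [C1 g0 hC]]] := mp_ddf_order H.
pose P := M `^ `|gam - 1|.
have P0 : 0 <= P by exact: powR_ge0.
exists (C ^+ 2 * P); first by rewrite mulr_ge0// exprn_ge0//; lra.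
move=> x y xI yI xy yx.
have /andP[_ hx] := hC x xI; have /andP[hy _] := hC y yI.
have x0 : 0 < x by case/andP: xI.
have y0 : 0 < y by case/andP: yI.
have := powR_comparable (gam - 1) M1 x0 y0 xy yx; rewrite -/P.
have X : 0 < x `^ (gam - 1) by exact: powR_gt0.
have Y : 0 < y `^ (gam - 1) by exact: powR_gt0.
move: hx hy; rewrite ler_pdivrMr// ler_pdivlMr//.
move: (dd x) (dd y) (x `^ _) (y `^ _) X Y => a b X Y X0 Y0 hx hy hXY.
have hY : Y <= C * b.
  by move: hy; rewrite ler_pdivrMl//; lra.
apply: (le_trans hx); rewrite expr2 -!mulrA ler_wpM2l//; first lra.
apply: (le_trans hXY); rewrite mulrCA ler_wpM2l//.
Qed.

Lemma mp_expanding_two_branch : exists M kappa L K,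
  expanding_two_branch r1 M kappa L K f d.
Proof.
have r0 := mp_r1_gt0; have r_1 := mp_r1_lt1.
have [L L0 lip] := mp_right_lipschitz.
have [kappa k1 hk] := mp_right_expand.
have [M hM] := mp_df_bounded H.
have dM x : 0 <= x <= 1 -> d x <= M.
  by move=> xI; apply: le_trans (ler_norm _) _; apply: hM; exists x.
have d0 : d 0 = 1 := mp_df0 H.
have M1 : 1 <= M by rewrite -d0; apply: dM; rewrite lexx ler01.
have [K K0 hK] := mp_second_comparable M1.
have dl t : 0 <= t < r1 -> 1 <= d t.
  by move=> /andP[t0 tr]; rewrite -d0; apply: mp_deriv_left_mono.
exists M, kappa, L, K; split=> //.
- exact: mp_r1 H.
- exact: mp_f0 H.
- exact: mp_fr1 H.
- exact: mp_f1 H.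
- move=> x /andP[x0 x1].
  have [->|xn0] := eqVneq x 0; first by rewrite (mp_f0 H) lexx ltr01.
  have [->|xnr] := eqVneq x r1; first by rewrite (mp_fr1 H) lexx ltr01.
  have x_gt0 : 0 < x by rewrite lt_neqAle eq_sym xn0.
  suff : `]0, 1[%classic (f x).
    by rewrite /= in_itv /= => /andP[/ltW-> ->].
  have [xr|xr] := ltP x r1.
    by rewrite -(mp_onto_l H); exists x => //; rewrite /= in_itv /= x_gt0.
  rewrite -(mp_onto_r H); exists x => //; rewrite /= in_itv /= x1 andbT.
  by rewrite lt_neqAle eq_sym xnr.
- move=> c y /andP[y0 y1]; have [->|yn0] := eqVneq y 0.
    case: c; [exists r1; last exact: mp_fr1 H|exists 0; last exact: mp_f0 H].
      by apply/andP.
    by apply/andP.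
  have y_gt0 : 0 < y by rewrite lt_neqAle eq_sym yn0.
  have yI : `]0, 1[%classic y by rewrite /= in_itv /= y_gt0.
  case: c.
    move: yI; rewrite -(mp_onto_r H) => -[x /= + <-]; rewrite in_itv /=.
    by move=> /andP[h1 h2]; exists x => //; apply/andP; split=> //; exact: ltW.
  move: yI; rewrite -(mp_onto_l H) => -[x /= + <-]; rewrite in_itv /=.
  by move=> /andP[h1 h2]; exists x => //; apply/andP; split=> //; exact: ltW.
- exact: mp_mvt_left.
- exact: mp_mvt_right.
- exact: mp_deriv_left_mono.
- move=> t tI; rewrite dl//= dM//; lra.
- move=> t /andP[t0 tr].
  have t1 : 0 < t <= 1 by lra.
  have dt1 : 1 <= d t by apply: dl; lra.
  by have := mp_expand H t1; rewrite ger0_norm//; lra.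
- by move=> t tI; apply: hk; lra.
- move=> s t rs st t1; have sI : r1 <= s <= 1 by lra.
  have tI : r1 <= t <= 1 by lra.
  have := lip t s tI sI.
  by rewrite (ger0_norm (_ : 0 <= t - s))// subr_ge0.
- move=> x s t s' t' x0 xs st tM tr xs' st' tM' tr'.
  have [xi /andP[h1 h2] ->] := mp_deriv_mvt_left (le_trans (ltW x0) xs) st tr.
  have [xi' /andP[h1' h2'] ->] :=
    mp_deriv_mvt_left (le_trans (ltW x0) xs') st' tr'.
  have xI : M * x <= M * xi by rewrite ler_wpM2l//; lra.
  have xI' : M * x <= M * xi' by rewrite ler_wpM2l//; lra.
  have xr : 0 < xi < r1 by lra.
  have xr' : 0 < xi' < r1 by lra.
  have := hK xi xi' xr xr' ltac:(lra) ltac:(lra).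
  have -> : K * (dd xi' * (t' - s')) * (t - s) =
    K * dd xi' * ((t - s) * (t' - s')) by ring.
  rewrite -mulrA; apply: ler_wpM2r; apply: mulr_ge0; lra.
Qed.

End FromMP.

(** * Serving countably many targets in the strong game *)

Section Game.
Context {R : realType}.
Implicit Types J : cinterval R.

Lemma len_gt0 J : 0 < len J.
Proof. by rewrite /len subr_gt0 lo_lt_hi. Qed.

Lemma left_quarter_lt J : lo J < lo J + len J / 4.
Proof. by have := len_gt0 J; lra. Qed.

Lemma right_quarter_lt J : hi J - len J / 4 < hi J.
Proof. by have := len_gt0 J; lra. Qed.

Definition quarter_away J (z : R) : cinterval R :=
  if (lo J + hi J) / 2 <= z then CInterval (left_quarter_lt J)
  else CInterval (right_quarter_lt J).

Lemma quarter_awayP J (z : R) : [/\ cset (quarter_away J z) `<=` cset J,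
  len (quarter_away J z) = len J / 4 &
  forall x, cset (quarter_away J z) x -> 1 / 4 * len J <= `|x - z|].
Proof.
have := len_gt0 J; rewrite /quarter_away.
case: ifPn => [|/negP/negP]; last rewrite -ltNge; move=> h l0; split.
- by move=> x; rewrite /cset /= !in_itv /=; move: l0; rewrite /len; lra.
- by rewrite /len /=; lra.
- move=> x; rewrite /cset /= in_itv /= => xI; rewrite distrC ler_normr.
  by apply/orP; left; move: h xI; rewrite /len; lra.
- by move=> x; rewrite /cset /= !in_itv /=; move: l0; rewrite /len; lra.
- by rewrite /len /=; lra.
- move=> x; rewrite /cset /= in_itv /= => xI; rewrite ler_normr.
  by apply/orP; left; move: h xI; rewrite /len; lra.
Qed.

Lemma cset_subset J J' : cset J `<=` cset J' -> lo J' <= lo J /\ hi J <= hi J'.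
Proof.
move=> sub; have hJ := ltW (lo_lt_hi J).
have := sub (lo J); have := sub (hi J); rewrite /cset /= !in_itv /= !lexx !hJ.
by move=> /(_ isT) /andP[_ ?] /(_ isT) /andP[].
Qed.

(** The turns [k], numbered from 0, for which [k + 1] has 2-adic valuation
    [i]. *)
Definition turn i j := (2 ^ i * j.*2.+1).-1.

Lemma turnS i j : (turn i j).+1 = (2 ^ i * j.*2.+1)%N.
Proof. by rewrite /turn prednK// muln_gt0 expn_gt0. Qed.

Lemma logn_turn i j : logn 2 (turn i j).+1 = i.
Proof.
rewrite turnS lognM ?expn_gt0// pfactorK// logn_coprime ?addn0//.
by rewrite coprime2n /= odd_double.
Qed.

Lemma turn_next i j : turn i j.+1 = (2 ^ i.+1 + turn i j)%N.
Proof.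
apply: succn_inj; rewrite -addnS !turnS expnS doubleS.
by rewrite !mulnS; lia.
Qed.

Definition scheduled (Z : nat -> R -> R -> R) : strategy R := fun h =>
  let J := last (unit_cinterval R) h in
  quarter_away J (Z (logn 2 (size h)) (lo J) (hi J)).

(** Successive turns that serve target [i] are [2 ^ i.+1] rounds apart, and each
    round divides the length by at most [4 / beta]. *)
Lemma scheduled_wins (beta : R) (Z : nat -> R -> R -> R) (S : set R) :
  0 < beta < 1 ->
  (forall x, 0 <= x <= 1 ->
     (forall i, served (Z i) ((beta / 4) ^+ (2 ^ i.+1)) (1 / 4) x) -> S x) ->
  winning_strategy (unit_cinterval R) (1 / 4) beta S (scheduled Z).
Proof.
move=> beta01 HS B A.
pose zn n := Z (logn 2 n.+1) (lo (B n)) (hi (B n)).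
have AE n : A n = quarter_away (B n) (zn n).
  rewrite /A /response /scheduled size_mkseq.
  by rewrite (last_nth (unit_cinterval R)) size_mkseq /= -[RHS]/(_) nth_mkseq.
split=> [n _|legal].
  have [sub l _] := quarter_awayP (B n) (zn n).
  by rewrite /alice_legal AE l; split=> //; lra.
have BA n : cset (B n.+1) `<=` cset (A n) by have [] := legal n.+1.
have AB n : cset (A n) `<=` cset (B n).
  by rewrite AE; have [] := quarter_awayP (B n) (zn n).
have lenA n : len (A n) = len (B n) / 4.
  by rewrite AE; have [] := quarter_awayP (B n) (zn n).
have ratio n : beta / 4 * len (B n) <= len (B n.+1).
  by have [_] := legal n.+1; rewrite lenA; lra.
have shrink n : len (B n.+1) <= len (B n) / 4.
  have [h1 h2] := cset_subset (BA n); rewrite -lenA /len; lra.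
have nested n k : cset (B (k + n)%N) `<=` cset (B n).
  by elim: k => // k IH x /BA/AB/IH.
have lohi m n : lo (B m) <= hi (B n).
  have [h1 _] := cset_subset (nested m n).
  have [_ h2] := cset_subset (nested n m).
  have := lo_lt_hi (B (n + m)%N); rewrite [in X in _ < X -> _]addnC => h.
  by apply: le_trans h1 (le_trans (ltW h) h2).
pose x := sup (range (fun n => lo (B n))).
have xB n : cset (B n) x.
  rewrite /cset /= in_itv /=; apply/andP; split.
    apply: ub_le_sup; last by exists n.
    by exists (hi (B 0%N)) => _ [m _ <-].
  by apply: ge_sup; [exists (lo (B 0%N)), 0%N|move=> _ [m _ <-]].
have xA n : cset (A n) x by apply: BA; exact: xB.
have x01 : 0 <= x <= 1.
  by have := legal 0%N x (xB 0%N); rewrite /cset /= in_itv.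
exists x; split=> //; apply: HS => // i.
pose t := turn i; exists (fun j => lo (B (t j))), (fun j => hi (B (t j))).
split.
- by move=> j; exact: lo_lt_hi.
- by move=> j; have := xB (t j); rewrite /cset /= in_itv.
- move=> j; rewrite /t turn_next -!/(len _).
  elim: (2 ^ i.+1)%N => [|k IH]; first by rewrite expr0 mul1r.
  rewrite exprS -mulrA addSn; apply: le_trans (ratio _).
  by rewrite ler_wpM2l//; lra.
- move=> e e0.
  have len_le n : len (B n) * n.+1%:R <= 1.
    elim: n => [|n IH].
      have [h1 h2] := cset_subset (legal 0%N).
      by rewrite mulr1; move: h1 h2; rewrite /len /=; lra.
    apply: le_trans IH.
    apply: (@le_trans _ _ (len (B n) / 4 * n.+2%:R)).
      by rewrite ler_wpM2r.
    rewrite -mulrA ler_wpM2l ?(ltW (len_gt0 _))//.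
    rewrite -[n.+2]addn1 natrD.
    have : 1 <= n.+1%:R :> R by rewrite ler1n.
    lra.
  have [n hn] : exists n : nat, e^-1 < n%:R.
    by exists (Num.bound e^-1); apply: archi_boundP; rewrite invr_ge0 ltW.
  have nt : (n <= t n)%N.
    rewrite -ltnS /t turnS -[n.+1]mul1n leq_mul ?expn_gt0//.
    by rewrite ltnS -addnn leq_addr.
  exists n; rewrite -/(len _) ltNge; apply/negP => h.
  have := len_le (t n); apply/negP; rewrite -ltNge.
  have h1 : 1 < e * n%:R by rewrite -ltr_pdivrMl// mulr1.
  apply: (lt_le_trans h1); apply: ler_pM => //; first exact: ltW.
  by rewrite ler_nat (leq_trans nt).
- move=> j; have [_ _ far] := quarter_awayP (B (t j)) (zn (t j)).
  have := far x; rewrite -AE => /(_ (xA _)).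
  by rewrite /zn logn_turn.
Qed.

End Game.

(** * Orbit closures avoiding a countable set *)

Lemma avoiding_criterion (R : realType) (f : R -> R) (P : set R) (x : R) :
  0 <= x <= 1 -> (forall p m, P p -> iter m f x != p) ->
  (forall p, P p -> exists2 eps, 0 < eps & exists m0, forall m, (m0 <= m)%N ->
    eps <= `|iter m f x - p|) ->
  orbit_avoiding f P x.
Proof.
move=> x01 neq away; split=> //; apply/seteqP; split=> // p [Pp] clp.
have [eps eps0 [m0 far]] := away p Pp.
have [e e0 all_far] : exists2 e, 0 < e & forall m, e <= `|iter m f x - p|.
  suff [e e0 he] : exists2 e, 0 < e &
      forall m, (m < m0)%N -> e <= `|iter m f x - p|.
    exists (Num.min e eps); first by rewrite lt_min e0.
    move=> m; rewrite ge_min; have [/he->//|/far->] := ltnP m m0.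
    by rewrite orbT.
  elim: (m0) => [|k [e e0 he]]; first by exists 1.
  exists (Num.min e `|iter k f x - p|).
    by rewrite lt_min e0 normr_gt0 subr_eq0 neq.
  move=> m; rewrite ltnS leq_eqVlt ge_min => /predU1P[->|/he->//].
  by rewrite lexx orbT.
have [_ [[m _ <-]]] := clp _ (nbhsx_ballx p e e0).
by rewrite /ball /= distrC ltNge all_far.
Qed.

Lemma countable_enum (R : realType) (Q : set R) (s : seq R) : countable Q ->
  exists e : nat -> R, forall q, Q q \/ q \in s -> exists n, e n = q.
Proof.
move=> /countable_injP[phi inj].
pose e0 n := xget 0 [set q | Q q /\ phi q = n].
exists (fun n => if (n < size s)%N then s`_n else e0 (n - size s)%N).
move=> q [Qq|qs]; last by exists (index q s); rewrite index_mem qs nth_index.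
exists (phi q + size s)%N; rewrite ltnNge leq_addl /= addnK /e0.
case: xgetP => [q' _ [Qq' e]|/(_ q)[]//].
by apply: inj; rewrite ?inE.
Qed.

Section Targets.
Context {R : realType} {r1 M kappa L K : R} {f d : R -> R}.
Hypothesis H : expanding_two_branch r1 M kappa L K f d.

Local Notation wd := (word_map r1 f).

Lemma iter_neq (q x : R) (m : nat) : 0 <= x <= 1 -> x != 1 ->
  (forall w, x != wd w q) -> iter m f x != q.
Proof.
move=> /andP[x0 x1] xn1 xw.
have orb : 0 <= iter m f x < 1.
  elim: m => [|m IH] /=; first by rewrite x0 lt_neqAle xn1.
  exact: (tb_unit H).
apply/eqP => e; have [w _ [_ xE]] := word_itinerary H x0 (proj2 (andP orb)) x1.
by have := xw w; rewrite -e -xE eqxx.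
Qed.

(** Targets are coded by a pair: [Some w] with [n] asks that [x] differ from
    [w (e n)], and [None] with [n] that the orbit stay away from [e n] from some
    time on. *)
Definition move_target (e : nat -> R) (z : nat -> nat -> R -> R -> R)
    (i : nat) : R -> R -> R :=
  match unpickle i : option (option (seq bool) * nat) with
  | Some (Some w, n) => fun _ _ => wd w (e n)
  | Some (None, n) => z n i
  | None => fun _ _ => 0
  end.

Lemma strong_winning_avoiding (P : set R) : countable P ->
  P `<=` `[0, 1]%classic ->
  strong_winning (unit_cinterval R) (1 / 4) (orbit_avoiding f P).
Proof.
move=> cP P01; split; first lra.
  by move=> x [x01 _]; rewrite /cset /= in_itv.
move=> beta beta01.
have r0 := r1_gt0 H; have r_1 := r1_lt1 H.
pose Q q := P q \/ q \in [:: 0; 1; r1].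
have [e eP] : exists e : nat -> R, forall q, Q q -> exists n, e n = q.
  exact: countable_enum.
pose lam i := (beta / 4) ^+ (2 ^ i.+1).
have lam0 i : 0 < lam i by rewrite exprn_gt0//; lra.
have /choice[z zP] : forall ni : nat * nat, exists z : R -> R -> R,
    0 < e ni.1 < 1 -> forall x, 0 <= x <= 1 -> served z (lam ni.2) (1 / 4) x ->
    exists2 eps, 0 < eps & exists m0, forall m, (m0 <= m)%N ->
      eps <= `|iter m f x - e ni.1|.
  move=> [n i] /=; have [e01|] := boolP (0 < e n < 1).
    have c0 : 0 < 1 / 4 :> R by lra.
    by have [z hz] := avoidance_point H e01 (lam0 i) c0; exists z.
  by exists (fun _ _ => 0).
exists (scheduled (move_target e (fun n i => z (n, i)))).
apply: scheduled_wins => // x x01 hserved.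
have xw q w : Q q -> x != wd w q.
  move=> /eP[n <-]; have := hserved (pickle (Some w, n)).
  rewrite /move_target pickleK => -[a [b [ab _ _ _ far]]].
  have := far 0%N; have := ab 0%N.
  by case: eqP => // ->; rewrite subrr normr0; lra.
(* The point 1 is outside the domain of the words, but it is its own only
   preimage, so that the empty word accounts for it. *)
have x_1 : x != 1 by apply: (xw 1 [::]); right; rewrite !inE eqxx orbT.
have neq q m : Q q -> iter m f x != q.
  by move=> Qq; apply: iter_neq => // w; exact: xw.
have away q : Q q -> 0 < q < 1 -> exists2 eps, 0 < eps & exists m0, forall m,
    (m0 <= m)%N -> eps <= `|iter m f x - q|.
  move=> /eP[n <-] q01; have := hserved (pickle (None : option (seq bool), n)).
  by rewrite /move_target pickleK; exact: (zP (n, _)).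
have Qr1 : Q r1 by right; rewrite !inE eqxx !orbT.
have [eps eps0 [m0 far]] := away r1 Qr1 (tb_r1 H).
have orb0 m : iter m f x != 0 by apply: neq; right; rewrite !inE eqxx.
have orb1 m : iter m f x != 1 by apply: neq; right; rewrite !inE eqxx orbT.
have [eta eta0 inner] := orbit_away_from_fixed_points H x01 orb0 orb1 eps0 far.
apply: avoiding_criterion => // [p m Pp|p Pp]; first by apply: neq; left.
have := P01 p Pp; rewrite /= in_itv /= => /andP[p0 p1].
have [->|p_0] := eqVneq p 0.
  exists eta => //; exists m0 => m /inner/andP[h _].
  by rewrite subr0; apply: le_trans h (ler_norm _).
have [->|p_1] := eqVneq p 1.
  exists eta => //; exists m0 => m /inner/andP[_ h].
  by rewrite distrC; apply: le_trans (ler_norm _); lra.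
apply: away; first by left.
by rewrite !lt_neqAle eq_sym p_0 p0 p_1 p1.
Qed.

End Targets.

Theorem corollary1p2 (R : realType) (f : R -> R) (hf : MP_map f) :
  exists alpha : R, 0 < alpha < 1 / 2 /\
    forall P : set R, countable P -> P `<=` `[0, 1]%classic ->
      strong_winning (unit_cinterval R) alpha (orbit_avoiding f P).
Proof.
have [r1 /mp_expanding_two_branch[M [kappa [L [K H]]]]] := hf.
exists (1 / 4); split; first lra.
exact: strong_winning_avoiding H.
Qed.
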